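(* For a subgroup $G<\widehat{\mathrm{Diff}}(\mathbb C^n,0)$ containing a regular dicritic diffeomorphism, the following conditions are equivalent: (1) $G$ is quasi-abelian; (2) $G$ admits a projectively invariant regular dicritic formal vector field.
   Context: $\widehat{\mathrm{Diff}}(\mathbb C^n,0)$ is the group (under composition) of formal diffeomorphisms of $\mathbb C^n$ fixing the origin. For $k\ge1$, $\widehat{\mathrm{Diff}}_k(\mathbb C^n,0)$ is the set of $\hat f(z)=z+f_{k+1}(z)+f_{k+2}(z)+\cdots$ with $f_j$ homogeneous of degree $j$ and $f_{k+1}\ne0$; $\hat{\mathcal X}_k(\mathbb C^n,0)$ is the set of formal vector fields whose coefficients have minimum vanishing order $k+1$ at $0$. The exponential $\exp(\hat X)=\big(\sum_j\frac1{j!}\hat X^j(z_i)\big)_{i}$ is a bijection $\hat{\mathcal X}_k\to\widehat{\mathrm{Diff}}_k$; the infinitesimal generator $\log\hat f$ of $\hat f\in\widehat{\mathrm{Diff}}_k$ is its preimage. $\hat X\in\hat{\mathcal X}_k(\mathbb C^n,0)$ is dicritic if $\hat X=f(z)\vec R+\sum_{i=1}^n(p^{(i)}_{k+2}+\cdots)\frac{\partial}{\partial z_i}$, with $f$ a homogeneous polynomial of degree $k$, $\vec R=\sum z_i\frac{\partial}{\partial z_i}$, $p^{(i)}_{k+2}$ homogeneous of degree $k+2$ and dots denoting higher order terms. It is regular dicritic if moreover there are $i_0,j_0\in\{1,\dots,n\}$ such that $f$ and $z_{j_0}p^{(i_0)}_{k+2}-z_{i_0}p^{(j_0)}_{k+2}$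 are coprime. $\hat f\in\widehat{\mathrm{Diff}}_k$ is regular dicritic if $\log\hat f$ is regular dicritic. $G$ is quasi-abelian if its subgroup $G_{\mathrm{Id}}$ of elements tangent to the identity (linear part $\mathrm{Id}$) is abelian. $\hat X$ is projectively invariant by $G$ if for each $\hat g\in G$ there is $c_{\hat g}\in\mathbb C$ with $\hat g_*\hat X=c_{\hat g}\hat X$. *)

(* Defs.v *)
From HB Require Import structures.
From mathcomp Require Import all_boot all_order all_algebra.
From mathcomp Require Import mpoly.
From mathcomp Require Import complex.
From mathcomp Require Import reals.

Set Implicit Arguments.
Unset Strict Implicit.
Unset Printing Implicit Defensive.

Import GRing.Theory.
Local Open Scope ring_scope.

(* A formal power series in n variables is its family of coefficients. *)
Definition fps (K : fieldType) (n : nat) : Type := 'X_{1..n} -> K.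

(* An n-tuple of series stands both for a formal self-map of (K^n, 0) and
   for the formal vector field \sum_i X_i d/dz_i. *)
Definition fpsn (K : fieldType) (n : nat) : Type := 'I_n -> fps K n.

Section FormalSeries.
Variables (K : fieldType) (n : nat).
Implicit Types (F H : fps K n) (f g h X : fpsn K n) (k d : nat).

Definition fps_of_poly (p : {mpoly K[n]}) : fps K n := fun m => p@_m.

Definition fps_trunc d F : {mpoly K[n]} :=
  \sum_(m : 'X_{1..n < d.+1}) F m *: 'X_[m].

Definition fps_mul F H : fps K n :=
  fun m => \sum_(a : 'X_{1..n < (mdeg m).+1, (mdeg m).+1} | m == (a.1 + a.2)%MM)
    F a.1 * H a.2.

Definition fps_deriv (i : 'I_n) F : fps K n :=
  fun m => F (m + U_(i))%MM *+ (m i).+1.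

(* The series F(g_1, ..., g_n), for g without constant terms: terms of degree
   > |m| of F and of the g_i do not contribute to the coefficient of z^m. *)
Definition fps_comp F g : fps K n :=
  fun m => (fps_trunc (mdeg m) F \mPo
              [tuple fps_trunc (mdeg m) (g i) | i < n])@_m.

Definition fcomp f g : fpsn K n := fun i => fps_comp (f i) g.

Definition fid : fpsn K n := fun i => fps_of_poly 'X_i.

Definition flinear f : 'M[K]_n := \matrix_(i, j) f i U_(j)%MM.

(* Elements of Diff^(K^n, 0). *)
Definition formal_diffeo f : Prop :=
  (forall i, f i 0%MM = 0) /\ flinear f \in unitmx.

Definition inverse_maps f h : Prop := fcomp f h = fid /\ fcomp h f = fid.

Definition diffeo_subgroup (G : fpsn K n -> Prop) : Prop :=
  [/\ forall f, G f -> formal_diffeo f,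
      G fid,
      forall f g, G f -> G g -> G (fcomp f g) &
      forall f, G f -> exists2 h, G h & inverse_maps f h].

Definition vanishing_order d f : Prop :=
  (forall i m, (mdeg m < d)%N -> f i m = 0) /\
  (exists i m, mdeg m = d /\ f i m != 0).

(* The set Diff^_k of the diffeomorphisms z + f_{k+1} + ..., f_{k+1} != 0. *)
Definition Diff_k k f : Prop :=
  vanishing_order k.+1 (fun i m => f i m - fid i m).

Definition X_k k X : Prop := vanishing_order k.+1 X.

(* The derivation of the ring of series defined by a vector field. *)
Definition vf_apply X F : fps K n :=
  fun m => \sum_(i < n) fps_mul (X i) (fps_deriv i F) m.

(* f = exp X: coefficientwise (Krull) convergence of the exponential series. *)
Definition is_exp X f : Prop :=
  forall i m, exists N : nat, forall J : nat, (N <= J)%N ->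
    \sum_(j < J) (j`!%:R)^-1 * iter j (vf_apply X) (fid i) m = f i m.

(* X = log f, the preimage of f under the bijection exp : X_k -> Diff_k. *)
Definition is_log k f X : Prop := [/\ Diff_k k f, X_k k X & is_exp X f].

Definition mpoly_coprime (p q : {mpoly K[n]}) : Prop :=
  forall d u v : {mpoly K[n]},
    p = d * u -> q = d * v -> d \is a GRing.unit.

(* X = q R + \sum_i (p_i + terms of degree > k+2) d/dz_i, R being the radial
   vector field. *)
Definition dicritic_form k X (q : {mpoly K[n]}) (p : 'I_n -> {mpoly K[n]}) :
    Prop :=
  [/\ q \is k.-homog,
      forall i, p i \is k.+2.-homog &
      forall i m, (mdeg m <= k.+2)%N -> X i m = (q * 'X_i + p i)@_m].

Definition dicritic k X : Prop :=
  X_k k X /\ exists q p, dicritic_form k X q p.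

Definition regular_dicritic k X : Prop :=
  X_k k X /\
  exists q p, dicritic_form k X q p /\
    exists i0 j0 : 'I_n, mpoly_coprime q ('X_j0 * p i0 - 'X_i0 * p j0).

Definition regular_dicritic_vf X : Prop :=
  exists2 k, (1 <= k)%N & regular_dicritic k X.

Definition regular_dicritic_diffeo f : Prop :=
  exists2 k, (1 <= k)%N & exists2 X, is_log k f X & regular_dicritic k X.

Definition tangent_to_id f : Prop := flinear f = 1%:M.

Definition quasi_abelian (G : fpsn K n -> Prop) : Prop :=
  forall f g, G f -> tangent_to_id f -> G g -> tangent_to_id g ->
    fcomp f g = fcomp g f.

(* g_* X = (Dg . X) o g^-1, with h standing for g^-1. *)
Definition pushforward g h X : fpsn K n :=
  fun i => fps_comp (vf_apply X (g i)) h.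

Definition projectively_invariant (G : fpsn K n -> Prop) X : Prop :=
  forall g h, G g -> inverse_maps g h -> formal_diffeo h ->
    exists c : K, pushforward g h X = fun i m => c * X i m.

End FormalSeries.

(* Main.v *)
Require Import Defs.
From HB Require Import structures.
From mathcomp Require Import all_boot all_order all_algebra.
From mathcomp Require Import mpoly complex boolp reals.
From mathcomp Require Import ring zify.

(** Write X = f R + p + ... for a regular dicritic field of order k + 1, R being
    the radial field.  If D is the lowest order part, of order l + 1, of a vector
    field commuting with X, or of the difference of two maps tangent to the
    identity whose substitutions commute with X, then [f R, D] = 0, that is
    l f D_i = D(f) z_i; multiplying by df/dz_i and summing, Euler's identity
    gives (l - k) f D(f) = 0, so l = k.

    Hence the centralizer of X in the group of maps tangent to the identity is
    abelian: two of its elements commute up to degree k + 1, and cannot differ at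
    a higher degree.  This gives (2) => (1), because a tangent to the identity
    element of G fixes an invariant field, not only up to a factor.

    For (1) => (2), take X = log phi.  For g in G, the maps phi and g^-1 phi g
    commute, so phi commutes with Y = g_* X, and therefore X commutes with Y.  The above
    gives Y = h R + T + ..., and the next terms of [X, Y] = 0 yield
    f (z_j T_i - z_i T_j) = h (z_j p_i - z_i p_j).  By coprimality f divides h, so
    h = c f, and Y - c X, of order > k + 1, vanishes. *)

Set Implicit Arguments.
Unset Strict Implicit.
Unset Printing Implicit Defensive.

Import GRing.Theory.
Local Open Scope ring_scope.

(** * GCD domains and Gauss's lemma *)

Section GcdDomain.

Definition divides (R : idomainType) (a b : R) : Prop := exists c, b = a * c.

(* Every fraction h / f has a reduced form c / a, reduced meaning that a
   divides every denominator of c / a: this is the GCD property. *)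
Definition gcd_domain (R : idomainType) : Prop :=
  forall f h : R, f != 0 -> exists g a c,
    [/\ f = g * a, h = g * c & forall A D, a * A = c * D -> divides a D].

Variable R : idomainType.
Hypothesis gcdR : gcd_domain R.
Implicit Types (a b c d e s : R) (f g h u v : {poly R}).

Definition divides_coefs c f : Prop := forall i, divides c f`_i.

Definition primitive f : Prop := forall c, divides_coefs c f -> divides c 1.

Lemma divides_trans b a c : divides a b -> divides b c -> divides a c.
Proof. by case=> d -> [e ->]; exists (d * e); rewrite mulrA. Qed.

Lemma dividesP_coefs c f : divides_coefs c f <-> exists g, f = c *: g.
Proof.
split=> [|[g -> i]]; last by exists g`_i; rewrite coefZ.
elim/poly_ind: f => [|f a IH] cf; first by exists 0; rewrite scaler0.
have [i|g ->] := IH.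
  by have := cf i.+1; rewrite coefD coefMX coefC addr0.
have := cf 0%N; rewrite coefD coefMX coefC add0r => -[b ->].
by exists (g * 'X + b%:P); rewrite scalerDr -!mul_polyC polyCM mulrA.
Qed.

Lemma primitive_neq0 f : primitive f -> f != 0.
Proof.
move=> pf; apply/eqP => f0; have [|c] := pf 0.
  by move=> i; exists 0; rewrite f0 coef0 mulr0.
by rewrite mul0r => /eqP; rewrite oner_eq0.
Qed.

(** Horner induction: the content of [f * 'X + a%:P] is the gcd of [a] and the content of [f], and
    the reduced form of their quotient supplies it. *)
Lemma content_exists f : exists c g, f = c *: g /\ primitive g.
Proof.
elim/poly_ind: f => [|f a [e [g [-> pg]]]].
  exists 0, 1; rewrite scale0r; split=> // c /(_ 0%N).
  by rewrite coef1.
have [->|a0] := eqVneq a 0.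
  exists e, (g * 'X); rewrite addr0 -scalerAl; split=> // c cg.
  by apply: pg => i; have := cg i.+1; rewrite coefMX.
have [d [a' [e' [ea ee red]]]] := gcdR e a0.
exists d, (e' *: g * 'X + a'%:P); split.
  by rewrite ea ee -!mul_polyC !polyCM; ring.
have a'0 : a' != 0 by apply: contraNneq a0 => a'0; rewrite ea a'0 mulr0.
move=> c cg; apply: pg.
have := cg 0%N; rewrite coefD coefMX coefC add0r /= => -[b eb].
move=> i; have := cg i.+1; rewrite coefD coefMX coefC addr0 /= coefZ => -[w ew].
(* As [a' = c * b], reducedness makes [a'] divide [b] times the coefficient of [g]; cancelling [b]
   leaves [c] dividing that coefficient. *)
have [|t et] := red w (b * g`_i).
  by rewrite eb -!mulrA mulrCA -ew; ring.
have b0 : b != 0 by apply: contraNneq a'0 => b0; rewrite eb b0 mulr0.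
by exists t; apply: (mulfI b0); rewrite et eb; ring.
Qed.

(* If d divides f u and the constant term of f, it divides (f - f(0)) u. *)
Lemma primitive_mul_step d f u :
    (forall g, (size g < size f)%N -> primitive g -> primitive (g * u)) ->
    primitive f -> primitive u -> f`_0 != 0 ->
    divides d f`_0 -> divides_coefs d (f * u) -> divides d 1.
Proof.
elim/poly_ind: f => [|p a _] IH pf pu a0.
  by rewrite coef0 eqxx in a0.
move: a0; rewrite coefD coefMX coefC add0r /= => a0 da du.
have d0 : d != 0.
  by case: da a0 => b ->; apply: contraNneq => ->; rewrite mul0r.
have {du} dpu i : divides d (p * u)`_i.
  have [b eb] := du i.+1; have [b' eb'] := da.
  exists (b - b' * u`_i.+1); rewrite mulrBr -eb mulrA -eb'.
  by rewrite mulrDl coefD mulrAC coefMX coefCM /=; ring.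
have [p0|pn0] := eqVneq p 0.
  apply: divides_trans da _; apply: pf => i.
  by rewrite p0 mul0r add0r coefC; case: eqP => _; [exists 1|exists 0];
    rewrite (mulr1, mulr0).
have [e [g [eg pg]]] := content_exists p.
have en0 : e != 0 by apply: contraNneq pn0 => e0; rewrite eg e0 scale0r.
have [w [d' [e' [ed ee red]]]] := gcdR e d0.
have w0 : w != 0 by apply: contraNneq d0 => w0; rewrite ed w0 mul0r.
(* [w] divides [e] and [d], and [d] divides [a], so [w] divides the primitive [f] and is a unit. It
   remains to treat [d']: reducedness makes it divide [g * u], where [g] is shorter than [f]. *)
have [w' ew'] : divides w 1.
  have [b eb] := da.
  apply: pf => i; rewrite coefD coefMX coefC.
  case: i => [|i] /=; last by exists (e' * g`_i); rewrite eg coefZ ee; ring.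
  by exists (d' * b); rewrite add0r eb ed mulrA.
have sg : (size g < size (p * 'X + a%:P)%R)%N.
  by rewrite size_MXaddC (negPf pn0) /= eg size_scale.
have [|d'' ed''] := IH g sg pg d'.
  move=> i; have [b eb] := dpu i; apply: (red b).
  apply: (mulfI w0); rewrite mulrA -ed -eb eg -scalerAl coefZ ee; ring.
exists (d'' * w'); rewrite ed.
by transitivity ((w * w') * (d' * d'')); [rewrite -ew' -ed'' mul1r|ring].
Qed.

Lemma primitive_mulX f : primitive (f * 'X) -> primitive f.
Proof.
move=> pf c cf; apply: pf => -[|i]; rewrite coefMX /=; last exact: (cf i).
by exists 0; rewrite mulr0.
Qed.

(** Induction on the sum of the sizes. Once factors ['X] are removed, a divisor [c] of [f * u]
    divides the product of the two constant terms, so it splits into a divisor [d] of the first and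
    a divisor [c'] of the second; [primitive_mul_step] disposes of each in turn. *)
Lemma primitive_mul f u : primitive f -> primitive u -> primitive (f * u).
Proof.
have [k] := ubnP (size f + size u); elim: k f u => // k IH f u sk pf pu.
have fn0 := primitive_neq0 pf; have un0 := primitive_neq0 pu.
have shift v : v`_0 = 0 -> v != 0 -> exists w, v = w * 'X /\ (size w < size v)%N.
  elim/poly_ind: v => [|v a _]; first by rewrite eqxx.
  rewrite coefD coefMX coefC add0r /= => ->; rewrite addr0 => vn0.
  exists v; split=> //; rewrite size_mulX //.
  by apply: contraNneq vn0 => ->; rewrite mul0r.
have [f0|f0] := eqVneq f`_0 0.
  have [g [eg sg]] := shift _ f0 fn0.
  rewrite eg mulrAC => c cf; apply: (IH g u) => //.
  - by rewrite -ltnS; apply: leq_trans sk; rewrite ltnS ltn_add2r.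
  - by apply: primitive_mulX; rewrite -eg.
  - by move=> i; have := cf i.+1; rewrite coefMX.
have [u0|u0] := eqVneq u`_0 0.
  have [g [eg sg]] := shift _ u0 un0.
  rewrite eg mulrA => c cf; apply: (IH f g) => //.
  - by rewrite -ltnS; apply: leq_trans sk; rewrite ltnS ltn_add2l.
  - by apply: primitive_mulX; rewrite -eg.
  - by move=> i; have := cf i.+1; rewrite coefMX.
move=> c cfu.
have c0 : c != 0.
  apply: contraNneq (mulf_neq0 fn0 un0) => c0.
  by apply/eqP/polyP => i; have [b ->] := cfu i; rewrite c0 mul0r coef0.
have stepf d : divides d f`_0 -> divides_coefs d (f * u) -> divides d 1.
  apply: primitive_mul_step => // g sg pg; apply: IH => //.
  by rewrite -ltnS; apply: leq_trans sk; rewrite ltnS ltn_add2r.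
have stepu d : divides d u`_0 -> divides_coefs d (f * u) -> divides d 1.
  rewrite mulrC; apply: primitive_mul_step => // g sg pg; rewrite mulrC.
  by apply: IH => //; rewrite -ltnS; apply: leq_trans sk; rewrite ltnS ltn_add2l.
have coefs d : divides d c -> divides_coefs d (f * u).
  by move=> dc i; apply: divides_trans dc (cfu i).
have [d [c' [a' [ec ea red]]]] := gcdR f`_0 c0.
have [b eb] := cfu 0%N.
have d0 : d != 0 by apply: contraNneq c0 => d0; rewrite ec d0 mul0r.
have [t et] : divides c' u`_0.
  apply: (red b); apply: (mulfI d0); rewrite mulrA -ec -eb mulrA -ea.
  by rewrite -!horner_coef0 hornerM.
have [d' ed'] : divides d 1 by apply: stepf; [exists a'|apply: coefs; exists c'].
apply: stepu => //; exists (d' * t); rewrite et ec.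
by transitivity ((d * d') * (c' * t)); [rewrite -ed' mul1r|ring].
Qed.

(** Write [u = e *: g] with [g] primitive. The reduced denominator of [e / c] divides the primitive
    [f * g], so it is a unit and [c] divides [e]. *)
Lemma gauss_primitive c f u :
  primitive f -> divides_coefs c (f * u) -> divides_coefs c u.
Proof.
move=> pf cfu.
have [e [g [eg pg]]] := content_exists u.
have [c0|c0] := eqVneq c 0.
  have /eqP : f * u = 0.
    by apply/polyP => i; have [b ->] := cfu i; rewrite c0 mul0r coef0.
  rewrite mulf_eq0 (negPf (primitive_neq0 pf)) => /eqP -> i.
  by rewrite coef0; exists 0; rewrite mulr0.
have [w [c' [e' [ec ee red]]]] := gcdR e c0.
have w0 : w != 0 by apply: contraNneq c0 => w0; rewrite ec w0 mul0r.
have [c'' ec''] : divides c' 1.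
  apply: (primitive_mul pf pg) => i; have [b eb] := cfu i.
  apply: (red b); apply: (mulfI w0); rewrite mulrA -ec -eb eg -scalerAr coefZ ee.
  by rewrite mulrA.
apply/dividesP_coefs; exists ((c'' * e') *: g).
by rewrite eg scalerA ee ec -mulrA (mulrA c') -ec'' mul1r.
Qed.

Lemma scale_poly_inj c : c != 0 -> injective (fun f => c *: f).
Proof. by move=> c0 f g; rewrite -!mul_polyC; apply: mulfI; rewrite polyC_eq0. Qed.

(** [gcdp] is a gcd over the fraction field only: its quotients [p] and [q] recover [f] and [h] up
    to the scalars [s] and [t]. Splitting off contents and applying Gauss's lemma clears these
    scalars. *)
Lemma gcd_domain_poly : gcd_domain {poly R}.
Proof.
move=> f h f0.
have [->|h0] := eqVneq h 0.
  exists f, 1, 0; rewrite mulr1 mulr0; split=> // A D _.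
  by exists D; rewrite mul1r.
pose g0 := gcdp f h.
have g00 : g0 != 0 by rewrite gcdp_eq0 negb_and f0.
have lg0 k : lead_coef g0 ^+ k != 0 by rewrite expf_neq0 // lead_coef_eq0.
have := Pdiv.Idomain.divpK (dvdp_gcdl f h); rewrite -/g0.
have := Pdiv.Idomain.divpK (dvdp_gcdr f h); rewrite -/g0.
have : coprimep (f %/ g0) (h %/ g0) by apply: coprimep_div_gcd; rewrite f0.
set p := f %/ g0; set q := h %/ g0; move=> cpq.
move: (lg0 (scalp h g0)) (lg0 (scalp f g0)).
set s := _ ^+ scalp f g0; set t := _ ^+ scalp h g0 => t0 s0 eq ep.
have p0 : p != 0.
  by apply: contraNneq f0 => e; move/eqP: ep; rewrite e mul0r eq_sym scale_poly_eq0 (negPf s0).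
have q0 : q != 0.
  by apply: contraNneq h0 => e; move/eqP: eq; rewrite e mul0r eq_sym scale_poly_eq0 (negPf t0).
have [x [p1 [ex pp1]]] := content_exists p.
have [y [q1 [ey pq1]]] := content_exists q.
have x0 : x != 0 by apply: contraNneq p0 => x0; rewrite ex x0 scale0r.
have y0 : y != 0 by apply: contraNneq q0 => y0; rewrite ey y0 scale0r.
have tx0 : t * x != 0 by rewrite mulf_neq0.
have [w [al [ga [eal ega red]]]] := gcdR (s * y) tx0.
have w0 : w != 0 by apply: contraNneq tx0 => w0; rewrite eal w0 mul0r.
have al0 : al != 0 by apply: contraNneq tx0 => e; rewrite eal e mulr0.
have ga0 : ga != 0.
  have : s * y != 0 by rewrite mulf_neq0.
  by apply: contraNneq => e; rewrite ega e mulr0.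
have [k [G [eG pG]]] := content_exists (w *: g0).
have ef : (s * t) *: f = (k * al) *: (p1 * G).
  transitivity ((t * x) *: (p1 * g0)).
    by rewrite (mulrC s) -(scalerA t s) -ep ex -!scalerAl scalerA.
  by rewrite eal (mulrC w) (mulrC k) -!scalerA (scalerAr k) -eG scalerAr.
have eh : (s * t) *: h = (k * ga) *: (q1 * G).
  transitivity ((s * y) *: (q1 * g0)).
    by rewrite -(scalerA s t) -eq ey -!scalerAl scalerA.
  by rewrite ega (mulrC w) (mulrC k) -!scalerA (scalerAr k) -eG scalerAr.
have st0 : s * t != 0 by rewrite mulf_neq0.
have contents_div v r z : primitive v -> (s * t) *: r = z *: (v * G) -> divides (s * t) z.
  move=> pv er; have := @gauss_primitive (s * t) (v * G) z%:P.
  case/(_ _ _ 0%N)=> [|i|b]; first exact: primitive_mul.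
    by rewrite (mulrC (v * G)) mul_polyC -er coefZ; exists r`_i.
  by rewrite coefC /= => ->; exists b.
have [b eb] := contents_div _ _ _ pp1 ef.
have [c ec] := contents_div _ _ _ pq1 eh.
(* The factor [si] of [s * t] that [k] does not absorb divides both [al] and [ga]; it is a unit
   because [ga / al] is reduced. Hence [s * t] divides [k]. *)
have [v [si [k' [esi ek rd]]]] := gcdR k st0.
have v0 : v != 0 by apply: contraNneq st0 => e; rewrite esi e mul0r.
have [al' eal'] : divides si al.
  by apply: (rd b); apply: (mulfI v0); rewrite !mulrA -esi -ek.
have [ga' ega'] : divides si ga.
  by apply: (rd c); apply: (mulfI v0); rewrite !mulrA -esi -ek.
have si0 : si != 0 by apply: contraNneq al0 => e; rewrite eal' e mul0r.
have [z ez] : divides al al'.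
  by apply: (red ga'); rewrite ega' eal'; ring.
have siz : si * z = 1.
  by apply: (mulfI al0); rewrite mulr1 [RHS]eal' ez; ring.
have ek' : k = (s * t) * (z * k').
  by rewrite esi ek; transitivity (v * (si * z) * k'); [rewrite siz mulr1|ring].
exists ((z * k') *: G), (al *: p1), (ga *: q1).
have inj := scale_poly_inj st0.
split; first by apply: inj; rewrite ef ek' -!scalerAl -!scalerAr !scalerA mulrC; congr (_ *: _); ring.
  by apply: inj; rewrite eh ek' -!scalerAl -!scalerAr !scalerA mulrC; congr (_ *: _); ring.
(* Coprimality of [p] and [q] gives [r' *: D = Q * p]; since [p1] is primitive, Gauss's lemma then
   lets [r'] be cancelled. *)
have p1D A D r : p1 * A = r *: (q1 * D) -> r != 0 -> divides p1 D.
  move=> e r0; have : p %| (r * x) *: (q * D).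
    apply/Pdiv.Idomain.dvdpP; exists (1, y *: A); rewrite ?oner_neq0 //= scale1r.
    rewrite ex ey -!scalerAl -!scalerAr !scalerA (mulrC A) e scalerA.
    by congr (_ *: _); ring.
  rewrite dvdpZr ?mulf_neq0 // Gauss_dvdpr // => /Pdiv.Idomain.dvdpP [[r' Q] /= r'0 eQ].
  have : divides_coefs r' (x *: Q).
    apply: (gauss_primitive pp1); apply/dividesP_coefs; exists D.
    by rewrite eQ ex -scalerAr -scalerAr mulrC.
  case/dividesP_coefs=> Q' eQ'; exists Q'.
  apply: (scale_poly_inj r'0); rewrite /= eQ scalerAr -eQ' ex -!scalerAr.
  by rewrite (mulrC Q).
move=> A D e; have : divides_coefs al D.
  apply: (gauss_primitive pq1) => i; apply: (red (p1 * A)`_i).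
  by rewrite -!coefZ scalerAl e scalerAl.
case/dividesP_coefs=> D' eD'.
have [|D'' eD''] := p1D A D' ga _ ga0.
  by apply: (scale_poly_inj al0); rewrite /= scalerAl e eD' -scalerAl -scalerAr !scalerA mulrC.
by exists D''; rewrite eD' eD'' -scalerAl.
Qed.

End GcdDomain.

Lemma gcd_domain_iso (A B : idomainType) (phi : {rmorphism A -> B})
    (psi : {rmorphism B -> A}) :
  cancel phi psi -> cancel psi phi -> gcd_domain B -> gcd_domain A.
Proof.
move=> phiK psiK gcdB f h f0.
have [|g [a [c [ef eh red]]]] := gcdB (phi f) (phi h).
  by rewrite -(can_eq psiK) phiK rmorph0.
exists (psi g), (psi a), (psi c); split.
- by rewrite -rmorphM -ef phiK.
- by rewrite -rmorphM -eh phiK.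
move=> x y e; have [|z ez] := red (phi x) (phi y).
  by rewrite -[a]psiK -[c]psiK -!rmorphM e.
by exists (psi z); rewrite -rmorphM -ez phiK.
Qed.

(** * Polynomials in several variables over a field form a GCD domain *)

Section MpolyGcd.
Variable K : fieldType.

(** Intended as the inverse of [muni]: the outer indeterminate becomes the last variable. *)
Definition of_poly_mpoly n (q : {poly {mpoly K[n]}}) : {mpoly K[n.+1]} :=
  (map_poly (@mwiden n K) q).['X_ord_max].

Fact of_poly_mpoly_is_zmod_morphism n : zmod_morphism (@of_poly_mpoly n).
Proof. by move=> p q; rewrite /of_poly_mpoly rmorphB hornerD hornerN. Qed.

Fact of_poly_mpoly_is_monoid_morphism n : monoid_morphism (@of_poly_mpoly n).
Proof.
by split=> [|p q]; rewrite /of_poly_mpoly ?rmorph1 ?hornerC // rmorphM hornerM.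
Qed.

HB.instance Definition _ n := GRing.isZmodMorphism.Build _ _ (@of_poly_mpoly n)
  (@of_poly_mpoly_is_zmod_morphism n).
HB.instance Definition _ n := GRing.isMonoidMorphism.Build _ _ (@of_poly_mpoly n)
  (@of_poly_mpoly_is_monoid_morphism n).

Lemma muniXn n (m : 'X_{1..n.+1}) : muni 'X_[m] =
  'X_[[multinom (m (widen_ord (leqnSn n) i)) | i < n]] *: 'X^(m ord_max)
    :> {poly {mpoly K[n]}}.
Proof. by rewrite muniE msuppX big_seq1 mcoeffX eqxx scale1r. Qed.

Lemma muniK n : cancel (@muni n K) (@of_poly_mpoly n).
Proof.
move=> p; rewrite [p in muni p]mpolyE [RHS]mpolyE (raddf_sum (@muni n K)).
rewrite (raddf_sum (@of_poly_mpoly n)) /=.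
apply: eq_bigr => m _; rewrite muniZ -mul_polyC rmorphM.
rewrite muniXn /= /of_poly_mpoly map_polyC hornerC /= mwidenC mul_mpolyC.
congr (_ *: _); rewrite map_polyZ /= map_polyXn hornerZ hornerXn mwidenX.
rewrite mpolyXn -mpolyXD; congr 'X_[_]; apply/mnmP => i.
rewrite mnmDE mulmnE mnm1E.
have [<-|ni] := eqVneq ord_max i; first by rewrite mnmwiden_ordmax mul1n.
rewrite mul0n addn0.
have [j ->] : exists j : 'I_n, i = widen_ord (leqnSn n) j.
  have lt_in : (i < n)%N.
    by rewrite ltn_neqAle -ltnS ltn_ord andbT; apply: contraNneq ni => e; apply/eqP/val_inj.
  by exists (Ordinal lt_in); apply: val_inj.
by rewrite mnmwiden_widen mnmE.
Qed.

Lemma of_poly_mpolyK n : cancel (@of_poly_mpoly n) (@muni n K).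
Proof.
move=> q; rewrite /of_poly_mpoly -[RHS]coefK poly_def horner_coef size_map_inj_poly ?mwiden0 //; last exact: inj_mwiden.
rewrite rmorph_sum; apply: eq_bigr => i _ /=.
rewrite rmorphM rmorphXn /= coef_map /= -mul_polyC; congr (_ * _); last first.
  rewrite muniXn mnm1E eqxx expr1 (_ : [multinom _ | _ < _] = 0%MM) ?mpolyX0 ?scale1r //.
  apply/mnmP => j; rewrite mnmE mnm1E mnm0E; case: eqP => // /(congr1 val) /= e.
  by have := ltn_ord j; rewrite -e ltnn.
move: q`_i => p; rewrite [p in LHS]mpolyE [p in RHS]mpolyE (raddf_sum (@mwiden n K)).
rewrite (raddf_sum (@muni n K)) (raddf_sum polyC) /=.
apply: eq_bigr => m _; rewrite mwidenZ muniZ -mul_mpolyC polyCM -mul_polyC; congr (_ * _).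
rewrite mwidenX muniXn mnmwiden_ordmax expr0 alg_polyC; congr ('X_[_]%:P).
by apply/mnmP => j; rewrite mnmE mnmwiden_widen.
Qed.

(** Induction on the number of variables through the isomorphism [muni]; without variables, every
    nonzero polynomial is a unit. *)
Lemma gcd_domain_mpoly n : gcd_domain {mpoly K[n]}.
Proof.
elim: n => [|n IH]; last first.
  exact: (gcd_domain_iso (@muniK n) (@of_poly_mpolyK n) (gcd_domain_poly IH)).
move=> f h f0; exists f, 1, (f^-1 * h).
have uf : f \is a GRing.unit.
  rewrite [f]nvar0_mpolyC in f0 *; rewrite mpolyC_eq0 in f0.
  by apply/unitrP; exists (f@_0)^-1%:MP; rewrite -!mpolyCM mulVf // mulfV.
rewrite mulr1; split=> // [|A D _]; first by rewrite mulrA mulrV // mul1r.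
by exists D; rewrite mul1r.
Qed.

(** In the reduced form [c / a] of [h / f], the denominator [a] divides both [f] and [g], so
    coprimality makes it a unit. *)
Lemma mpoly_coprime_euclid n (f g h A : {mpoly K[n]}) :
  f != 0 -> mpoly_coprime f g -> f * A = h * g -> divides f h.
Proof.
move=> f0 cfg e; have [d [a [c [ef eh red]]]] := @gcd_domain_mpoly n f h f0.
have d0 : d != 0 by apply: contraNneq f0 => d0; rewrite ef d0 mul0r.
have [b eb] : divides a g.
  by apply: (red A); apply: (mulfI d0); rewrite !mulrA -ef -eh.
have ua : a \is a GRing.unit by apply: (cfg a d b) => //; rewrite mulrC.
by exists (a^-1 * c); rewrite eh ef mulrA mulrK.
Qed.

End MpolyGcd.

(** * Order of vanishing, derivations and substitutions of polynomials *)

Section MpolyOrder.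
Variables (K : fieldType) (n : nat).
Implicit Types (p q r : {mpoly K[n]}) (P Q f g h : 'I_n -> {mpoly K[n]}).
Implicit Types (m : 'X_{1..n}) (a b d s : nat).

Lemma mnm_ind (T : 'X_{1..n} -> Prop) :
  T 0%MM -> (forall i m, T m -> T (U_(i) + m)%MM) -> forall m, T m.
Proof.
move=> T0 TS m; have [k] := ubnP (mdeg m); elim: k m => // k IH m.
have [->//|m0] := eqVneq m 0%MM; rewrite ltnS => sm.
have [i mi] : exists i, m i != 0%N.
  apply/existsP; rewrite -negb_forall; apply: contraNN m0 => /forallP m0.
  by apply/eqP/mnmP => i; rewrite mnm0E; apply/eqP/m0.
have em : (U_(i) + (m - U_(i)) = m)%MM by rewrite addmC submK // lep1mP.
rewrite -em; apply: TS; apply: IH; apply: leq_trans sm.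
by rewrite -{2}em mdegD mdeg1.
Qed.

Lemma mpoly_monomial_ind (T : {mpoly K[n]} -> Prop) :
  T 1 -> (forall i p, T p -> T ('X_i * p)) ->
  (forall p q, T p -> T q -> T (p + q)) -> (forall c p, T p -> T (c *: p)) ->
  forall p, T p.
Proof.
move=> T1 TX TD TZ; elim/mpolyind => [|c m p _ _ Tp].
  by rewrite -(scale0r 1); apply: TZ.
apply: TD => //; apply: TZ; elim/mnm_ind: m => [|i m Tm].
  by rewrite mpolyX0.
by rewrite mpolyXD; apply: TX.
Qed.

(** A lower bound for the order at the origin; [ord d (p - q)] serves throughout as congruence
    modulo terms of degree at least [d]. *)
Definition ord d p : Prop := forall m, (mdeg m < d)%N -> p@_m = 0.

Lemma ordW a b p : (a <= b)%N -> ord b p -> ord a p.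
Proof. by move=> ab op m ma; apply: op; apply: leq_trans ab. Qed.

Lemma ord_geq0 p : ord 0 p.
Proof. by []. Qed.

Lemma ord_zero d : ord d 0.
Proof. by move=> m _; rewrite mcoeff0. Qed.

Lemma ordD d p q : ord d p -> ord d q -> ord d (p + q).
Proof. by move=> op oq m md; rewrite mcoeffD op // oq // addr0. Qed.

Lemma ordN d p : ord d p -> ord d (- p).
Proof. by move=> op m md; rewrite mcoeffN op // oppr0. Qed.

Lemma ordB d p q : ord d p -> ord d q -> ord d (p - q).
Proof. by move=> op oq; apply: ordD => //; apply: ordN. Qed.

Lemma ordZ d c p : ord d p -> ord d (c *: p).
Proof. by move=> op m md; rewrite mcoeffZ op // mulr0. Qed.

Lemma ord_sum d (I : Type) (r : seq I) (S : pred I) (F : I -> {mpoly K[n]}) :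
  (forall i, S i -> ord d (F i)) -> ord d (\sum_(i <- r | S i) F i).
Proof.
by move=> oF; elim/big_ind: _ => //; [apply: ord_zero | apply: ordD].
Qed.

Lemma ordM a b p q : ord a p -> ord b q -> ord (a + b) (p * q).
Proof.
move=> op oq m md; rewrite mcoeffM; apply: big1 => k /eqP em.
have [ka|ka] := ltnP (mdeg k.1) a; first by rewrite op // mul0r.
have := congr1 (@mdeg n) em; rewrite mdegD => e.
rewrite oq ?mulr0 // -(ltn_add2l (mdeg k.1)) -e.
by apply: leq_trans md _; rewrite leq_add2r.
Qed.

Lemma ordMr d p q : ord d p -> ord d (q * p).
Proof. by move=> op; rewrite -[d]add0n; apply: ordM. Qed.

Lemma ordMl d p q : ord d p -> ord d (p * q).
Proof. by move=> op; rewrite mulrC; apply: ordMr. Qed.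

Lemma ordX m : ord (mdeg m) 'X_[m].
Proof.
move=> m' lt; rewrite mcoeffX; case: eqP => // em.
by rewrite em ltnn in lt.
Qed.

Lemma ordX1 i : ord 1 'X_i.
Proof. by rewrite -(mdeg1 i); apply: ordX. Qed.

Lemma ord_mderiv d i p : ord d p -> ord d.-1 p^`M(i).
Proof.
move=> op m md; rewrite mcoeff_deriv op ?mul0rn // mdegD mdeg1; lia.
Qed.

Lemma ord_homog d p : p \is d.-homog -> ord d p.
Proof.
move=> hp m md; apply: (dhomog_nemf_coeff hp); by rewrite neq_ltn md.
Qed.

Lemma homog_ord_eq0 d p : p \is d.-homog -> ord d.+1 p -> p = 0.
Proof.
move=> hp op; apply/mpolyP => m; rewrite mcoeff0.
have [md|md] := eqVneq (mdeg m) d; first by apply: op; rewrite md.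
exact: (dhomog_nemf_coeff hp).
Qed.

Lemma ord_subC d p q : ord d (p - q) -> ord d (q - p).
Proof. by move=> o; rewrite -opprB; apply: ordN. Qed.

Lemma ord_trans d q p r : ord d (p - q) -> ord d (q - r) -> ord d (p - r).
Proof. by move=> o1 o2; rewrite -(subrKA q); apply: ordD. Qed.

Lemma ord_subM d p p' q q' :
  ord d (p - p') -> ord d (q - q') -> ord d (p * q - p' * q').
Proof.
move=> op oq; rewrite (_ : _ - _ = (p - p') * q + p' * (q - q')); last by ring.
by apply: ordD; [apply: ordMl|apply: ordMr].
Qed.

Definition der P p : {mpoly K[n]} := \sum_(i < n) P i * p^`M(i).

Fact der_is_zmod_morphism P : zmod_morphism (der P).
Proof.
move=> p q; rewrite /der -sumrB; apply: eq_bigr => i _.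
by rewrite mderivB mulrBr.
Qed.

Fact der_is_scalable P : scalable (der P).
Proof.
move=> c p; rewrite /der scaler_sumr; apply: eq_bigr => i _.
by rewrite mderivZ scalerAr.
Qed.

HB.instance Definition _ P := GRing.isZmodMorphism.Build _ _ (der P)
  (der_is_zmod_morphism P).
HB.instance Definition _ P := GRing.isScalable.Build _ _ _ _ (der P)
  (der_is_scalable P).

Lemma derM P p q : der P (p * q) = der P p * q + p * der P q.
Proof.
rewrite /der mulr_suml mulr_sumr -big_split; apply: eq_bigr => i _ /=.
by rewrite mderivM; ring.
Qed.

Lemma derX P i : der P 'X_i = P i.
Proof.
rewrite /der (bigD1 i) //= big1 => [|j ji]; last first.
  by rewrite mderivX mnm1E eq_sym (negPf ji) scale0r mulr0.
rewrite addr0 mderivX mnm1E eqxx scale1r (_ : (_ - _)%MM = 0%MM) ?mpolyX0 ?mulr1 //.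
by apply/mnmP => j; rewrite mnmBE subnn mnm0E.
Qed.

Lemma der1 P : der P 1 = 0.
Proof. by rewrite /der big1 // => i _; rewrite -mpolyC1 mderivC mulr0. Qed.

Lemma derDl P Q p : der (fun i => P i + Q i) p = der P p + der Q p.
Proof. by rewrite /der -big_split; apply: eq_bigr => i _ /=; rewrite mulrDl. Qed.

Lemma derBl P Q p : der (fun i => P i - Q i) p = der P p - der Q p.
Proof. by rewrite /der -sumrB; apply: eq_bigr => i _ /=; rewrite mulrBl. Qed.

Lemma derMl r P p : der (fun i => r * P i) p = r * der P p.
Proof. by rewrite /der mulr_sumr; apply: eq_bigr => i _ /=; rewrite mulrA. Qed.

Lemma ord_der d s P p : (forall i, ord s.+1 (P i)) -> ord d p -> ord (d + s) (der P p).
Proof.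
move=> oP op; apply: ord_sum => i _.
by apply: ordW (ordM (oP i) (ord_mderiv i op)); lia.
Qed.

Lemma ord_derl d P p : (forall i, ord d (P i)) -> ord d (der P p).
Proof. by move=> oP; apply: ord_sum => i _; apply: ordMl. Qed.

(** No precision is lost: differentiating [p - q] costs one degree, which the order 1 of [P] gives
    back. *)
Lemma der_congr d P Q p q : (forall i, ord 1 (P i)) ->
  (forall i, ord d (P i - Q i)) -> ord d (p - q) -> ord d (der P p - der Q q).
Proof.
move=> oP oPQ opq; rewrite (_ : _ - _ = der P (p - q) + (der P q - der Q q)).
  apply: ordD; first by rewrite -[d]addn0; apply: ord_der.
  by rewrite -derBl; apply: ord_derl.
by rewrite raddfB /=; ring.
Qed.

Lemma homog_der d s P p : (forall i, P i \is s.+1.-homog) -> p \is d.-homog ->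
  der P p \is (d + s).-homog.
Proof.
move=> hP hp; apply: rpred_sum => i _; apply/dhomogP => m.
move/msuppM_le => /allpairsP [[m1 m2] /= [i1 i2 ->]].
rewrite /= mdegD (dhomog_mf (hP i) i1).
move: i2; rewrite mcoeff_msupp mcoeff_deriv => nz.
have : p@_(m2 + U_(i)) != 0 by apply: contraNneq nz => ->; rewrite mul0rn.
by rewrite -mcoeff_msupp => /(dhomog_mf hp) /=; rewrite mdegD mdeg1; lia.
Qed.

Lemma der_radial_euler d p : p \is d.-homog -> der (fun i => 'X_i) p = p *+ d.
Proof.
move=> hp; rewrite [p in LHS]mpolyE [p in RHS]mpolyE (raddf_sum (der _)) /= -sumrMnl.
rewrite [LHS]big_seq [RHS]big_seq; apply: eq_bigr => m ms.
rewrite linearZ /= scalerMnr; congr (_ *: _).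
rewrite -(dhomog_mf hp ms) /=; elim/mnm_ind: {ms} m => [|i m IH].
  by rewrite mdeg0 mpolyX0 der1.
by rewrite mpolyXD derM derX IH mdegD mdeg1 mulrnDr mulr1n mulrnAr.
Qed.

Definition subst g : n.-tuple {mpoly K[n]} := [tuple g i | i < n].

Lemma substX g i : 'X_i \mPo subst g = g i.
Proof. by rewrite comp_mpolyXU -tnth_nth tnth_mktuple. Qed.

Lemma subst_id p : p \mPo subst (fun i => 'X_i) = p.
Proof. exact: comp_mpoly_id. Qed.

Lemma ord_subst d p g : (forall i, ord 1 (g i)) -> ord d p -> ord d (p \mPo subst g).
Proof.
move=> og op; rewrite comp_mpolyEX big_seq; apply: ord_sum => m ms.
apply: ordZ; have dm : (d <= mdeg m)%N.
  by rewrite leqNgt; apply/negP => /op; apply/eqP; rewrite -mcoeff_msupp.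
apply: ordW dm _; elim/mnm_ind: {ms} m => [|i m IH]; first by rewrite mdeg0.
by rewrite mpolyXD rmorphM /= substX mdegD mdeg1; apply: ordM.
Qed.

Lemma subst_congr d p q f g : (forall i, ord 1 (f i)) -> 
  (forall i, ord d (f i - g i)) -> ord d (p - q) ->
  ord d ((p \mPo subst f) - (q \mPo subst g)).
Proof.
move=> of1 ofg opq. apply: (ord_trans (q := q \mPo subst f)).
  by rewrite -rmorphB; apply: ord_subst.
move: q {opq}; apply: mpoly_monomial_ind => [|i r IH|r r' or or'|c r or].
- by rewrite !rmorph1 subrr; apply: ord_zero.
- by rewrite !rmorphM /= !substX; apply: ord_subM.
- by rewrite !rmorphD opprD addrACA; apply: ordD.
- by rewrite !comp_mpolyZ -scalerBr; apply: ordZ.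
Qed.

Lemma subst_comp p f g :
  (p \mPo subst f) \mPo subst g = p \mPo subst (fun i => f i \mPo subst g).
Proof.
move: p; apply: mpoly_monomial_ind => [|i r IH|r r' er er'|c r er].
- by rewrite !rmorph1.
- by rewrite !rmorphM /= !substX IH.
- by rewrite !rmorphD /= er er'.
- by rewrite !comp_mpolyZ er.
Qed.

Lemma der_chain_rule P p g :
  der P (p \mPo subst g) = \sum_i (p^`M(i) \mPo subst g) * der P (g i).
Proof.
move: p; apply: mpoly_monomial_ind => [|j r IH|r r' er er'|c r er].
- rewrite rmorph1 der1 big1 // => i _.
  by rewrite -mpolyC1 mderivC rmorph0 mul0r.
- rewrite rmorphM /= substX derM IH.
  have e i : (('X_j * r)^`M(i) \mPo subst g) * der P (g i) =
      (r \mPo subst g) * (('X_j^`M(i) \mPo subst g) * der P (g i)) +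
      g j * ((r^`M(i) \mPo subst g) * der P (g i)).
    by rewrite mderivM rmorphD !rmorphM /= substX; ring.
  rewrite [RHS](eq_bigr _ (fun i _ => e i)).
  rewrite big_split -!mulr_sumr mulrC; congr (_ * _ + _).
  rewrite (bigD1 j) //= big1 => [|i ij]; last first.
    by rewrite mderivX mnm1E eq_sym (negPf ij) scale0r rmorph0 mul0r.
  rewrite addr0 mderivX mnm1E eqxx scale1r (_ : (_ - _)%MM = 0%MM).
    by rewrite mpolyX0 rmorph1 mul1r.
  by apply/mnmP => i; rewrite mnmBE subnn mnm0E.
- rewrite rmorphD raddfD /= er er' -big_split; apply: eq_bigr => i _ /=.
  by rewrite mderivD rmorphD mulrDl.
- rewrite comp_mpolyZ linearZ /= er scaler_sumr; apply: eq_bigr => i _.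
  by rewrite mderivZ comp_mpolyZ scalerAl.
Qed.

End MpolyOrder.

(** * The exponential of a derivation *)

Section MpolyExp.
Variables (K : fieldType) (n : nat).
Hypothesis charK : [pchar K] =i pred0.
Variable X : 'I_n -> {mpoly K[n]}.
Hypothesis ordX2 : forall i, ord 2 (X i).
Implicit Types (p q : {mpoly K[n]}) (j J : nat).

Definition exp_term j p := (j`!%:R)^-1 *: iter j (der X) p.

Definition exp_sum J p := \sum_(j < J) exp_term j p.

Let natK j : j.+1%:R != 0 :> K.
Proof. by rewrite ((pcharf0P _).1 charK). Qed.

Lemma ord_iter_der d j p : ord d p -> ord (d + j) (iter j (der X) p).
Proof.
move=> op; elim: j => [|j IH]; first by rewrite addn0.
by rewrite addnS -addn1; apply: ord_der.
Qed.

Lemma ord_exp_term j p : ord j (exp_term j p).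
Proof. by apply: ordZ; rewrite -[j in ord j]add0n; apply: ord_iter_der. Qed.

Lemma der_exp_term j p : der X (exp_term j p) = j.+1%:R *: exp_term j.+1 p.
Proof.
rewrite /exp_term linearZ /= scalerA factS natrM invfM mulrA mulfV ?mul1r //.
Qed.

Lemma iter_derB j p q : iter j (der X) (p - q) = iter j (der X) p - iter j (der X) q.
Proof. by elim: j => //= j ->; rewrite raddfB. Qed.

Lemma iter_derZ j c p : iter j (der X) (c *: p) = c *: iter j (der X) p.
Proof. by elim: j => //= j ->; rewrite linearZ. Qed.

Lemma exp_sumB J p q : exp_sum J (p - q) = exp_sum J p - exp_sum J q.
Proof.
rewrite /exp_sum -sumrB; apply: eq_bigr => j _.
by rewrite /exp_term iter_derB scalerBr.
Qed.

Lemma exp_sumZ J c p : exp_sum J (c *: p) = c *: exp_sum J p.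
Proof.
rewrite /exp_sum scaler_sumr; apply: eq_bigr => j _.
by rewrite /exp_term iter_derZ !scalerA mulrC.
Qed.

Lemma exp_sumD J p q : exp_sum J (p + q) = exp_sum J p + exp_sum J q.
Proof.
rewrite (_ : p + q = p - (-1) *: q); last by rewrite scaleN1r opprK.
by rewrite exp_sumB exp_sumZ scaleN1r opprK.
Qed.

Lemma exp_sum1 J : exp_sum J.+1 1 = 1.
Proof.
rewrite /exp_sum big_ord_recl /exp_term /= fact0 invr1 scale1r big1 ?addr0 //.
move=> j _; rewrite (_ : der X _ = 0) ?scaler0 //.
by elim: (nat_of_ord j) => [|k /= ->]; rewrite /= ?der1 ?raddf0.
Qed.

(** Leibniz rule for divided powers of a derivation. The induction step is proved after
    multiplication by [j + 1], which is split as [a + (j + 1 - a)] in each term. *)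
Lemma exp_termM j p q :
  exp_term j (p * q) = \sum_(a < j.+1) exp_term a p * exp_term (j - a) q.
Proof.
elim: j => [|j IH].
  by rewrite big_ord1 subn0 /exp_term /= fact0 invr1 !scale1r.
have inj : injective (fun p : {mpoly K[n]} => j.+1%:R *: p).
  move=> u v /(congr1 (fun w => j.+1%:R^-1 *: w)).
  by rewrite !scalerA mulVf // !scale1r.
apply: inj => /=; rewrite -der_exp_term IH raddf_sum /=.
have e a : der X (exp_term a p * exp_term (j - a) q) =
    a.+1%:R *: (exp_term a.+1 p * exp_term (j - a) q)
    + (j - a).+1%:R *: (exp_term a p * exp_term (j - a).+1 q).
  by rewrite derM !der_exp_term -scalerAl -(scalerAr (j - a).+1%:R).
rewrite (eq_bigr _ (fun (a : 'I_j.+1) _ => e a)) big_split /=.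
have e' (a : 'I_j.+2) : j.+1%:R *: (exp_term a p * exp_term (j.+1 - a) q) =
    a%:R *: (exp_term a p * exp_term (j.+1 - a) q)
    + (j.+1 - a)%:R *: (exp_term a p * exp_term (j.+1 - a) q).
  by rewrite -scalerDl -natrD subnKC // -ltnS.
rewrite scaler_sumr (eq_bigr _ (fun a _ => e' a)) big_split /=; congr (_ + _).
  by rewrite [RHS]big_ord_recl scale0r add0r; apply: eq_bigr => a _; rewrite /= /bump add1n subSS.
rewrite [RHS]big_ord_recr /= subnn scale0r addr0; apply: eq_bigr => a _ /=.
by rewrite subSn // -ltnS.
Qed.

(** The partial sums are values at 1 of polynomials [U p], [U q] in an auxiliary variable. Below
    index [J], the coefficients of [U p * U q] are given by the Leibniz rule; from [J] on they have
    order at least [J]. *)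
Lemma exp_sumM J p q : ord J (exp_sum J (p * q) - exp_sum J p * exp_sum J q).
Proof.
pose U r : {poly {mpoly K[n]}} := \poly_(j < J) exp_term j r.
have e r : exp_sum J r = (U r).[1].
  rewrite (horner_coef_wide _ (size_poly _ _)); apply: eq_bigr => j _.
  by rewrite coef_poly ltn_ord expr1n mulr1.
have -> : exp_sum J p * exp_sum J q = \sum_(j < J + J) (U p * U q)`_j.
  rewrite (e p) (e q) -hornerM (horner_coef_wide (n := J + J)); last first.
    apply: leq_trans (size_polyMleq _ _) _; apply: leq_trans (leq_pred _) _.
    by apply: leq_add; apply: size_poly.
  by apply: eq_bigr => j _; rewrite expr1n mulr1.
rewrite big_split_ord /= opprD addrA -sumrB; apply: ordB; apply: ord_sum => j _.
  rewrite coefM exp_termM -sumrB; apply: ord_sum => a _.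
  have la : (a < J)%N by apply: leq_ltn_trans (ltn_ord j); rewrite -ltnS.
  have lb : (j - a < J)%N by apply: leq_ltn_trans (leq_subr _ _) (ltn_ord j).
  by rewrite !coef_poly la lb subrr; apply: ord_zero.
rewrite coefM; apply: ord_sum => a _; rewrite !coef_poly.
case: ifP => _; last by rewrite mul0r; apply: ord_zero.
case: ifP => _; last by rewrite mulr0; apply: ord_zero.
apply: ordW (ordM (@ord_exp_term _ _) (@ord_exp_term _ _)).
by rewrite subnKC ?leq_addr // -ltnS.
Qed.

Variables (N : nat) (f : 'I_n -> {mpoly K[n]}).
Hypothesis expXf : forall i, ord N.+1 (f i - exp_sum N.+1 'X_i).

(** Substitution of [f] is multiplicative, and so is the exponential modulo degree [N + 1];
    agreement on the coordinates therefore extends to all polynomials. *)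
Lemma subst_exp p : ord N.+1 ((p \mPo subst f) - exp_sum N.+1 p).
Proof.
move: p; apply: mpoly_monomial_ind => [|i p op|p q op oq|c p op].
- by rewrite rmorph1 exp_sum1 subrr; apply: ord_zero.
- apply: (ord_trans (q := exp_sum N.+1 'X_i * exp_sum N.+1 p)); last first.
    exact/ord_subC/exp_sumM.
  by rewrite rmorphM /= substX; apply: ord_subM.
- by rewrite rmorphD exp_sumD opprD addrACA; apply: ordD.
- by rewrite comp_mpolyZ exp_sumZ -scalerBr; apply: ordZ.
Qed.

(* [T, exp X] = [T, X] + (terms of higher order), so the order of [T, X] can
   be raised indefinitely. *)
Lemma commute_exp (T : {linear {mpoly K[n]} -> {mpoly K[n]}}) :
  (forall d p, ord d p -> ord d (T p)) ->
  (forall p, ord N.+1 (T (p \mPo subst f) - (T p \mPo subst f))) ->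
  forall p, ord N.+1 (T (der X p) - der X (T p)).
Proof.
move=> oT comT.
have comE p : ord N.+1 (T (exp_sum N.+1 p) - exp_sum N.+1 (T p)).
  apply: (ord_trans _ (subst_exp (T p))); apply: (ord_trans _ (comT p)).
  by rewrite -raddfB; apply: oT; apply: ord_subC; apply: subst_exp.
(* [s] is the amount by which [T, X] is known to raise orders, up to the cutoff [N + 1]. *)
suff step s d p : ord d p -> ord (minn (d + s) N.+1) (T (der X p) - der X (T p)).
  by move=> p; have := @step N.+1 0 p (ord_geq0 p); rewrite add0n minnn.
elim: s d p => [|s IH] d p op.
  apply: ordW (geq_minl _ _) _; rewrite addn0; apply: ordB; first apply: oT.
    by apply: (ordW (b := d + 1)); rewrite ?leq_addr //; apply: ord_der.
  by apply: (ordW (b := d + 1)); rewrite ?leq_addr //; apply: ord_der => //; apply: oT.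
have iterC j d' p' : ord d' p' ->
    ord (minn (d' + s + j) N.+1) (T (iter j.+1 (der X) p') - iter j.+1 (der X) (T p')).
  move=> op'; elim: j => [|j IHj]; first by rewrite addn0; apply: IH.
  rewrite [iter j.+2 _ p']iterS [iter j.+2 _ (T p')]iterS.
  apply: (ord_trans (q := der X (T (iter j.+1 (der X) p')))).
    apply: (ordW _ (IH _ _ (ord_iter_der (j := j.+1) op'))); lia.
  rewrite -raddfB; apply: (ordW _ (ord_der (s := 1) ordX2 IHj)); lia.
have := comE p; rewrite /exp_sum raddf_sum -sumrB big_ord_recl.
rewrite /exp_term /= fact0 invr1 !scale1r subrr add0r.
(* For [N = 0] the sum stops before the term of index 1, but then order 1 is all that is asked, and
   it is clear. *)
move: IH iterC; case: (N) => [|N'] IH iterC.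
  move=> _; apply: (ordW (geq_minr _ _)).
  by apply: ordB; [apply: oT|]; rewrite -[1%N]/(0 + 1)%N; apply: ord_der.
rewrite big_ord_recl /= /bump /= addn0 factS fact0 muln1 invr1 !scale1r => ocomm.
(* The term of index 1 is [T, X] itself; those of index at least 2, collected in [r], gain at least
   one order more by [iterC]. *)
set r := \sum_(i < _) _ in ocomm.
have or : ord (minn (d + s.+1) N'.+2) r.
  apply: ord_sum => j _; rewrite linearZ -scalerBr; apply: ordZ.
  by apply: (ordW _ (iterC j.+1 _ _ op)); lia.
rewrite -(addrK r (_ - _)); apply: ordB => //; apply: (ordW _ ocomm); lia.
Qed.

End MpolyExp.

(** * Truncation of formal power series *)

Section FpsTruncation.
Variables (K : fieldType) (n : nat).
Implicit Types (F H : fps K n) (f g h X Y : fpsn K n) (m : 'X_{1..n}).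
Implicit Types (p : {mpoly K[n]}) (N d : nat).

Definition no_const f : Prop := forall i, f i 0%MM = 0.

Definition truncs N f : 'I_n -> {mpoly K[n]} := fun i => fps_trunc N (f i).

Lemma mcoeff_trunc N F m : (mdeg m <= N)%N -> (fps_trunc N F)@_m = F m.
Proof. by move=> mN; rewrite /fps_trunc mcoeff_mpoly. Qed.

Lemma ord_truncP N F p :
  ord N.+1 (fps_trunc N F - p) <-> forall m, (mdeg m <= N)%N -> F m = p@_m.
Proof.
split=> oF m mN.
  have := oF m mN; rewrite mcoeffB mcoeff_trunc // => /eqP.
  by rewrite subr_eq0 => /eqP.
by rewrite mcoeffB mcoeff_trunc // oF // subrr.
Qed.

Lemma truncs_ord1 N f : no_const f -> forall i, ord 1 (truncs N f i).
Proof.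
move=> f0 i m; rewrite ltnS leqn0 mdeg_eq0 => /eqP ->.
by rewrite mcoeff_trunc ?mdeg0 // f0.
Qed.

Lemma trunc_trunc N d F : (d <= N)%N -> ord d.+1 (fps_trunc d F - fps_trunc N F).
Proof.
by move=> dN; apply/ord_truncP => m md; rewrite mcoeff_trunc // (leq_trans md).
Qed.

(** Differentiation brings terms of [F] of degree [N + 1], lost by truncation, down to degree [N];
    there they meet only the constant terms of [X], which vanish. *)
Lemma vf_applyE N X F m : no_const X -> (mdeg m <= N)%N ->
  vf_apply X F m = (der (truncs N X) (fps_trunc N F))@_m.
Proof.
move=> X0 mN; rewrite /vf_apply /der (raddf_sum (mcoeff m)); apply: eq_bigr => i _.
rewrite /= mcoeffM; apply: eq_bigr => -[[k1 ?] [k2 ?]] /= /eqP em.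
have := congr1 (@mdeg n) em; rewrite mdegD => e.
have k1N : (mdeg k1 <= N)%N by apply: leq_trans mN; rewrite e leq_addr.
rewrite /truncs mcoeff_trunc //.
have [->|k10] := eqVneq k1 0%MM; first by rewrite X0 !mul0r.
have k2N : (mdeg k2 < N)%N.
  apply: leq_trans mN; rewrite e -[X in (X < _)%N]add0n ltn_add2r.
  by rewrite lt0n mdeg_eq0.
by rewrite mcoeff_deriv mcoeff_trunc // mdegD mdeg1 addn1.
Qed.

(** Makes the truncation degree independent of [m], so that one polynomial substitution describes
    all coefficients up to degree [N]. *)
Lemma fps_compE N F g m : no_const g -> (mdeg m <= N)%N ->
  fps_comp F g m = (fps_trunc N F \mPo subst (truncs N g))@_m.
Proof.
move=> g0 mN; rewrite /fps_comp.
apply/eqP; rewrite -subr_eq0 -mcoeffB; apply/eqP.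
apply: (@subst_congr _ _ (mdeg m).+1 _ _ (truncs (mdeg m) g)) => //.
- exact: truncs_ord1.
- by move=> i; apply: trunc_trunc.
- exact: trunc_trunc.
Qed.

Lemma trunc_vf_apply N X F : no_const X ->
  ord N.+1 (fps_trunc N (vf_apply X F) - der (truncs N X) (fps_trunc N F)).
Proof. by move=> X0; apply/ord_truncP => m; apply: vf_applyE. Qed.

Lemma trunc_fps_comp N F g : no_const g ->
  ord N.+1 (fps_trunc N (fps_comp F g) - (fps_trunc N F \mPo subst (truncs N g))).
Proof. by move=> g0; apply/ord_truncP => m; apply: fps_compE. Qed.

Lemma trunc_of_poly N p : ord N.+1 (fps_trunc N (fps_of_poly p) - p).
Proof. exact/ord_truncP. Qed.

Lemma trunc_inj F H :
  (forall N, (0 < N)%N -> ord N.+1 (fps_trunc N F - fps_trunc N H)) -> F = H.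
Proof.
move=> e; apply/funext => m; have /ord_truncP := e (mdeg m).+1 isT.
by move=> /(_ m (leqnSn _)) ->; rewrite mcoeff_trunc.
Qed.

Lemma fps_comp_const F g : no_const g -> fps_comp F g 0%MM = F 0%MM.
Proof.
move=> g0; rewrite (fps_compE (N := 0)) ?mdeg0 //.
have := @mcoeff_trunc 0 F 0%MM; rewrite mdeg0 => /(_ isT) <-.
move: (fps_trunc 0 F); apply: mpoly_monomial_ind => [|i p _|p q ep eq|c p ep].
- by rewrite rmorph1.
- rewrite rmorphM /= substX.
  have z (q : {mpoly K[n]}) : ord 1 q -> q@_0%MM = 0 by apply; rewrite mdeg0.
  by rewrite !z //; apply: ordMl; [apply: ordX1|apply: truncs_ord1].
- by rewrite rmorphD !mcoeffD ep eq.
- by rewrite comp_mpolyZ !mcoeffZ ep.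
Qed.

Lemma no_const_fcomp f g : no_const f -> no_const g -> no_const (fcomp f g).
Proof. by move=> f0 g0 i; rewrite /fcomp fps_comp_const. Qed.

Lemma no_const_fid : no_const (@fid K n).
Proof. by move=> i; rewrite /fid /fps_of_poly mcoeffX mnm1_eq0. Qed.

Lemma fps_comp_assoc F g h : no_const g -> no_const h ->
  fps_comp (fps_comp F g) h = fps_comp F (fcomp g h).
Proof.
move=> g0 h0; apply: trunc_inj => N _.
apply: (ord_trans (trunc_fps_comp (fps_comp F g) h0)).
apply: (ord_trans _ (ord_subC (trunc_fps_comp F (no_const_fcomp g0 h0)))).
apply: (ord_trans (q := (fps_trunc N F \mPo subst (truncs N g)) \mPo subst (truncs N h))).
  apply: subst_congr; last exact: trunc_fps_comp.
    exact: truncs_ord1.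
  by move=> i; rewrite subrr; apply: ord_zero.
rewrite subst_comp; apply: subst_congr.
- by move=> i; apply: ord_subst; apply: truncs_ord1.
- by move=> i; apply: ord_subC; apply: trunc_fps_comp.
- by rewrite subrr; apply: ord_zero.
Qed.

Lemma fps_comp_fid F : fps_comp F (@fid K n) = F.
Proof.
apply: trunc_inj => N _; apply: (ord_trans (trunc_fps_comp F no_const_fid)).
rewrite -[X in ord _ (_ - X)]subst_id; apply: subst_congr.
- exact/truncs_ord1/no_const_fid.
- by move=> i; apply: trunc_of_poly.
- by rewrite subrr; apply: ord_zero.
Qed.

Lemma fcomp_assoc f g h : no_const g -> no_const h ->
  fcomp (fcomp f g) h = fcomp f (fcomp g h).
Proof. by move=> g0 h0; apply/funext => i; apply: fps_comp_assoc. Qed.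

Lemma fcomp_fid f : fcomp f (@fid K n) = f.
Proof. by apply/funext => i; apply: fps_comp_fid. Qed.

Lemma fps_comp_fidl i g : no_const g -> fps_comp (@fid K n i) g = g i.
Proof.
move=> g0; apply: trunc_inj => N _.
apply: (ord_trans (trunc_fps_comp _ g0)).
rewrite -[X in ord _ (_ - X)](substX (truncs N g)); apply: subst_congr.
- exact: truncs_ord1.
- by move=> j; rewrite subrr; apply: ord_zero.
- exact: trunc_of_poly.
Qed.

Lemma fid_fcomp g : no_const g -> fcomp (@fid K n) g = g.
Proof. by move=> g0; apply/funext => i; apply: fps_comp_fidl. Qed.

Lemma vf_apply_const X F : no_const X -> vf_apply X F 0%MM = 0.
Proof.
move=> X0; rewrite (vf_applyE (N := 0)) ?mdeg0 //.
suff : ord 1 (der (truncs 0 X) (fps_trunc 0 F)) by apply; rewrite mdeg0.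
by apply: ord_derl; apply: truncs_ord1.
Qed.

Lemma no_const_pushforward g h X : no_const X -> no_const h ->
  no_const (pushforward g h X).
Proof.
by move=> X0 h0 i; rewrite /pushforward fps_comp_const // vf_apply_const.
Qed.

(** As a derivation, the push-forward is [X] conjugated by the substitution of [g]. This is the
    chain rule, in which [fcomp g h = fid] removes the substitution from the partial derivatives of
    [F]. *)
Lemma vf_apply_pushforward g h X F :
    no_const X -> no_const g -> no_const h -> fcomp g h = @fid K n ->
  vf_apply (pushforward g h X) F = fps_comp (vf_apply X (fps_comp F g)) h.
Proof.
move=> X0 g0 h0 gh; apply: trunc_inj => N _.
have Y0 := no_const_pushforward g X0 h0.
apply: (ord_trans (trunc_vf_apply F Y0)).
apply: (ord_trans _ (ord_subC (trunc_fps_comp _ h0))).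
set q := fps_trunc N F; set Xn := truncs N X; set gn := truncs N g.
set hn := truncs N h.
have on1 := truncs_ord1 N.
apply: (ord_trans (q := der Xn (q \mPo subst gn) \mPo subst hn)); last first.
  apply: ord_subC; apply: subst_congr; first exact: on1.
    by move=> i; rewrite subrr; apply: ord_zero.
  apply: (ord_trans (trunc_vf_apply _ X0)); apply: der_congr; first exact: on1.
    by move=> i; rewrite subrr; apply: ord_zero.
  exact: trunc_fps_comp.
rewrite der_chain_rule rmorph_sum /= /der -sumrB; apply: ord_sum => i _.
rewrite mulrC rmorphM /=; apply: ord_subM.
  rewrite -[X in ord _ (X - _)]subst_id subst_comp; apply: subst_congr.
  - by move=> j; apply: ordX1.
  - move=> j; apply: ord_subC; apply: (ord_trans _ (trunc_of_poly _)).
    rewrite -[fps_of_poly _]/(@fid K n j) -gh.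
    exact/ord_subC/trunc_fps_comp.
  - by rewrite subrr; apply: ord_zero.
apply: (ord_trans (trunc_fps_comp _ h0)); apply: subst_congr; first exact: on1.
  by move=> j; rewrite subrr; apply: ord_zero.
exact: trunc_vf_apply.
Qed.

End FpsTruncation.

(** * Exponentials of formal vector fields and commutation *)

Section FpsExp.
Variables (K : fieldType) (n : nat).
Hypothesis charK : [pchar K] =i pred0.
Implicit Types (F H : fps K n) (g h t Y : fpsn K n) (m : 'X_{1..n}).

Definition ords d (f : fpsn K n) : Prop :=
  forall i m, (mdeg m < d)%N -> f i m = 0.

Lemma ords_no_const d f : ords d.+1 f -> no_const f.
Proof. by move=> of1 i; apply: of1; rewrite mdeg0. Qed.

Lemma ords_truncs N d f : ords d f -> (d <= N.+1)%N -> forall i, ord d (truncs N f i).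
Proof.
by move=> o dN i m md; rewrite mcoeff_trunc ?o // -ltnS; apply: leq_trans dN.
Qed.

Lemma ords_truncs1 N d f : ords d.+1 f -> (d <= N)%N -> forall i, ord d.+1 (truncs N f i).
Proof. by move=> o dN; apply: ords_truncs. Qed.

Variables X f : fpsn K n.
Hypothesis X2 : ords 2 X.
Hypothesis f0 : no_const f.
Hypothesis expXf : is_exp X f.

Let X0 := ords_no_const X2.

Lemma trunc_iter_vf_apply N j F : ord N.+1
  (fps_trunc N (iter j (vf_apply X) F) - iter j (der (truncs N X)) (fps_trunc N F)).
Proof.
elim: j => [|j IH] /=; first by rewrite subrr; apply: ord_zero.
apply: (ord_trans (trunc_vf_apply _ X0)); apply: der_congr => //.
  exact: truncs_ord1.
by move=> i; rewrite subrr; apply: ord_zero.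
Qed.

Lemma truncs_is_exp N i : (1 <= N)%N ->
  ord N.+1 (truncs N f i - exp_sum (truncs N X) N.+1 'X_i).
Proof.
move=> N1; apply/ord_truncP => m mN; have [J0 eJ] := expXf i m.
(* Adding [J0] puts the sum in its stationary range; the terms of index above [N] vanish at [m],
   since the term of index [j] has order at least [j]. *)
have {eJ} <- := eJ (N.+1 + J0)%N (leq_addl _ _).
have e j : iter j (vf_apply X) (fid K i) m = (iter j (der (truncs N X)) 'X_i)@_m.
  have /ord_truncP : ord N.+1 (fps_trunc N (iter j (vf_apply X) (fid K i))
      - iter j (der (truncs N X)) 'X_i).
    apply: (ord_trans (trunc_iter_vf_apply _ _)).
    elim: j => [|j IH] /=; first exact: trunc_of_poly.
    apply: der_congr => //; first exact: truncs_ord1.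
    by move=> k; rewrite subrr; apply: ord_zero.
  exact.
rewrite big_split_ord /= [X in _ + X]big1 => [|j _]; last first.
  rewrite -[vf_apply X _]iterS e -mcoeffZ; apply: (@ord_exp_term _ _ (truncs N X) _ _ _ m _).
    by apply: ords_truncs1.
  by apply: leq_ltn_trans mN _; rewrite ltnS leq_addr.
rewrite addr0 /exp_sum (raddf_sum (mcoeff m)); apply: eq_bigr => j _.
by rewrite e /= mcoeffZ.
Qed.

Lemma commute_is_exp N (T : {linear {mpoly K[n]} -> {mpoly K[n]}}) : (1 <= N)%N ->
  (forall d p, ord d p -> ord d (T p)) ->
  (forall p, ord N.+1 (T (p \mPo subst (truncs N f)) - (T p \mPo subst (truncs N f)))) ->
  forall p, ord N.+1 (T (der (truncs N X) p) - der (truncs N X) (T p)).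
Proof.
move=> N1; apply: commute_exp => //.
- by apply: ords_truncs1.
- by move=> i; apply: truncs_is_exp.
Qed.

(** Here [commute_exp] is applied to the substitution of [t], which commutes with that of [f], the
    exponential of [X]. *)
Lemma vf_apply_fcomp_commute t F : no_const t -> fcomp t f = fcomp f t ->
  vf_apply X (fps_comp F t) = fps_comp (vf_apply X F) t.
Proof.
move=> t0 tf; apply: trunc_inj => N N1.
have tn := truncs_ord1 N t0.
have cF := trunc_fps_comp F t0; have cX := trunc_vf_apply F X0.
apply: (ord_trans (trunc_vf_apply _ X0)).
apply: (ord_trans _ (ord_subC (trunc_fps_comp _ t0))).
have idX i : ord N.+1 (truncs N X i - truncs N X i) by rewrite subrr; apply: ord_zero.
have idt i : ord N.+1 (truncs N t i - truncs N t i) by rewrite subrr; apply: ord_zero.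
apply: (ord_trans (q := der (truncs N X) (fps_trunc N F \mPo subst (truncs N t)))).
  by apply: der_congr => //; apply: truncs_ord1.
apply: (ord_trans (q := der (truncs N X) (fps_trunc N F) \mPo subst (truncs N t))); last first.
  by apply: subst_congr => //; apply: ord_subC.
apply: ord_subC; move: (fps_trunc N F).
apply: (commute_is_exp (T := comp_mpoly (subst (truncs N t)))) => // [d p op|p].
  exact: ord_subst.
rewrite /= !subst_comp; apply: subst_congr; last by rewrite subrr; apply: ord_zero.
  by move=> i; apply: ord_subst => //; apply: truncs_ord1.
move=> i; apply: (ord_trans (q := fps_trunc N (fcomp f t i))).
  exact/ord_subC/trunc_fps_comp.
by rewrite -tf; apply: trunc_fps_comp.
Qed.

(** Here [commute_exp] is applied to the derivation [Y]; the bracket is then evaluated on the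
    coordinates. *)
Lemma vf_apply_commute Y : no_const Y ->
  (forall F, vf_apply Y (fps_comp F f) = fps_comp (vf_apply Y F) f) ->
  forall i, vf_apply X (Y i) = vf_apply Y (X i).
Proof.
move=> Y0 Yf i; apply: trunc_inj => N N1.
apply: (ord_trans (trunc_vf_apply _ X0)).
apply: (ord_trans _ (ord_subC (trunc_vf_apply _ Y0))).
apply: ord_subC.
rewrite -[fps_trunc N (X i)](derX (truncs N X) i) -[fps_trunc N (Y i)](derX (truncs N Y) i).
have idY j : ord N.+1 (truncs N Y j - truncs N Y j) by rewrite subrr; apply: ord_zero.
have idf j : ord N.+1 (truncs N f j - truncs N f j) by rewrite subrr; apply: ord_zero.
have Y1 := truncs_ord1 N Y0; have f1 := truncs_ord1 N f0.
apply: (commute_is_exp (T := der (truncs N Y))) => // [d p op|p].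
  by rewrite -[d]addn0; apply: ord_der.
have := trunc_vf_apply (N := N) (fps_comp (fps_of_poly p) f) Y0.
rewrite Yf => e; apply: (ord_trans (q := fps_trunc N (fps_comp (vf_apply Y (fps_of_poly p)) f))).
  apply: (ord_trans _ (ord_subC e)); apply: der_congr => //.
  apply: ord_subC; apply: (ord_trans (trunc_fps_comp _ f0)).
  by apply: subst_congr => //; apply: trunc_of_poly.
apply: (ord_trans (trunc_fps_comp _ f0)); apply: subst_congr => //.
apply: (ord_trans (trunc_vf_apply _ Y0)); apply: der_congr => //.
exact: trunc_of_poly.
Qed.

(** Since [fcomp g t = fcomp f g], conjugation by [g] turns the substitution of [f] into that of
    [t], which commutes with [X] because [t] commutes with [f]. Hence the push-forward commutes with
    the substitution of [f], and so with its logarithm. *)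
Lemma pushforward_commute g h :
    no_const g -> no_const h -> fcomp g h = @fid K n -> fcomp h g = @fid K n ->
    let t := fcomp h (fcomp f g) in fcomp t f = fcomp f t ->
    let Y := pushforward g h X in
  forall i, vf_apply X (Y i) = vf_apply Y (X i).
Proof.
move=> g0 h0 gh hg t tf Y; apply: vf_apply_commute.
  exact: no_const_pushforward.
have fg0 := no_const_fcomp f0 g0; have hf0 := no_const_fcomp h0 f0.
have t0 : no_const t by apply: no_const_fcomp.
have gt : fcomp g t = fcomp f g by rewrite /t -(fcomp_assoc g h0 fg0) gh (fid_fcomp fg0).
have th : fcomp t h = fcomp h f.
  by rewrite /t (fcomp_assoc h fg0 h0) (fcomp_assoc f g0 h0) gh fcomp_fid.
move=> F; rewrite !(vf_apply_pushforward _ X0 g0 h0 gh) (fps_comp_assoc F f0 g0) -gt.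
rewrite -(fps_comp_assoc F g0 t0) (vf_apply_fcomp_commute _ t0 tf).
by rewrite (fps_comp_assoc _ t0 h0) (fps_comp_assoc _ h0 f0) th.
Qed.

End FpsExp.

(** * Lowest order terms *)

Section LeadingTerms.
Variables (K : fieldType) (n : nat).
Hypothesis charK : [pchar K] =i pred0.
Implicit Types (p q h r : {mpoly K[n]}) (P Q W : 'I_n -> {mpoly K[n]}).

Lemma mulrn_mpoly_eq0 p k : (0 < k)%N -> p *+ k = 0 -> p = 0.
Proof.
move=> k0 /(congr1 (fun r => k%:R^-1 *: r)); rewrite scaler0 -scaler_nat scalerA.
by rewrite mulVf ?scale1r // ((pcharf0P _).1 charK) -lt0n.
Qed.

(** Approximations of [P] and [p] good to [e] further orders yield the derivative up to [e] orders
    above its expected order [d + s]. The cases [e = 1] and [e = 2] extract first and second lowest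
    terms. *)
Lemma der_congr_lead s d e P Q p q :
    (forall i, ord s.+1 (P i)) -> (forall i, ord (s + e).+1 (P i - Q i)) ->
    ord d q -> ord (d + e) (p - q) ->
  ord (d + s + e) (der P p - der Q q).
Proof.
move=> oP oPQ oq opq.
rewrite (_ : _ - _ = der P (p - q) + der (fun i => P i - Q i) q); last first.
  by rewrite derBl raddfB /=; ring.
apply: ordD; first by rewrite addnAC; apply: ord_der.
by rewrite -addnA; apply: ord_der.
Qed.

Lemma der_radial_field k q p : p \is k.-homog ->
  der (fun i => q * 'X_i) p = q * p *+ k.
Proof. by move=> hp; rewrite derMl (der_radial_euler hp) mulrnAr. Qed.

Lemma homogMX k q i : q \is k.-homog -> q * 'X_i \is k.+1.-homog.
Proof. by move=> hq; rewrite -addn1; apply: dhomogM; rewrite // dhomogX /= mdeg1. Qed.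

Lemma radial_commute k l q W : q \is k.-homog -> (forall i, W i \is l.+1.-homog) ->
    (forall i, ord (k + l).+2 (der (fun j => q * 'X_j) (W i) - der W (q * 'X_i))) ->
  forall i, q * W i *+ l = der W q * 'X_i.
Proof.
move=> hq hW oW i; apply/eqP; rewrite -subr_eq0; apply/eqP.
apply: (@homog_ord_eq0 _ _ (k + l).+1).
  apply: rpredB; first by apply: rpredMn; rewrite -addnS; apply: dhomogM.
  by apply: homogMX; apply: homog_der.
move: (oW i); rewrite (der_radial_field _ (hW i)) derM derX mulrSr.
by rewrite opprD addrACA [_ * W i - _]subrr addr0.
Qed.

Lemma radial_commute_eq0 k l q W : q != 0 -> q \is k.-homog ->
    (0 < l)%N -> l != k -> (forall i, q * W i *+ l = der W q * 'X_i) ->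
  forall i, W i = 0.
Proof.
move=> q0 hq l0 lk eW.
have e : (q * der W q) *+ l = (q * der W q) *+ k.
  transitivity (\sum_i (q * W i *+ l) * q^`M(i)).
    rewrite /der mulr_sumr -sumrMnl; apply: eq_bigr => i _.
    by rewrite mulrnAl mulrA.
  rewrite (eq_bigr _ (fun i _ => congr1 (fun x => x * q^`M(i)) (eW i))).
  rewrite -mulrnAl -(der_radial_euler hq) mulrC [X in _ * X]/der mulr_sumr.
  by apply: eq_bigr => i _; rewrite mulrA.
have qd0 : q * der W q = 0.
  have [lt|lt|eq] := ltngtP l k; last by rewrite eq eqxx in lk.
    apply: (@mulrn_mpoly_eq0 _ (k - l)); rewrite ?subn_gt0 // mulrnBr ?(ltnW lt) //.
    by rewrite e subrr.
  apply: (@mulrn_mpoly_eq0 _ (l - k)); rewrite ?subn_gt0 // mulrnBr ?(ltnW lt) //.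
  by rewrite e subrr.
have d0 : der W q = 0 by apply: (mulfI q0); rewrite qd0 mulr0.
move=> i; apply: (mulfI q0); rewrite mulr0.
by apply: (mulrn_mpoly_eq0 l0); rewrite eW d0 mul0r.
Qed.

(** Every monomial of [p] contains z_i: its product with z_j occurs in ['X_i * q], and [j] differs
    from [i]. The quotient is then formed monomial by monomial. *)
Lemma mulX_eq_dvd (i j : 'I_n) p q : i != j -> 'X_j * p = 'X_i * q ->
  exists h, p = h * 'X_i.
Proof.
move=> ij e; exists (\sum_(m <- msupp p) p@_m *: 'X_[m - U_(i)]).
rewrite [LHS]mpolyE mulr_suml; apply: eq_big_seq => m ms.
rewrite -scalerAl -mpolyXD submK // lep1mP; apply/negP => /eqP mi.
have := congr1 (fun r => (m + U_(j))%MM \in msupp r) e.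
rewrite !(mulrC 'X__) !(perm_mem (msuppMX _ _)) addmC map_f // => /esym.
case/mapP=> m' _ /mnmP /(_ i); rewrite !mnmDE !mnm1E eqxx mi.
by rewrite eq_sym (negPf ij).
Qed.

(** First-order Taylor formula along the lowest part [W] of [u - v]. As [u] and [v] are tangent to
    the identity, taking the derivative at the identity instead of at [v] does not affect the lowest
    order. *)
Lemma taylor_subst d l (u v : 'I_n -> {mpoly K[n]}) W p : (forall i, ord 2 (u i - 'X_i)) ->
    (forall i, ord 2 (v i - 'X_i)) -> (forall i, ord l.+2 (u i - v i - W i)) ->
    (forall i, ord l.+1 (W i)) -> ord d p ->
  ord (d + l.+1) ((p \mPo subst u) - (p \mPo subst v) - der W p).
Proof.
move=> ou ov ouv oW.
have ou1 i : ord 1 (u i).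
  by rewrite -(subrK 'X_i (u i)); apply: ordD (@ordX1 _ _ i); apply: (ordW _ (ou i)).
have ov1 i : ord 1 (v i).
  by rewrite -(subrK 'X_i (v i)); apply: ordD (@ordX1 _ _ i); apply: (ordW _ (ov i)).
have oX1 i := @ordX1 K n i.
have stepv m : ord (mdeg m).+1 (('X_[m] \mPo subst v) - 'X_[m]).
  elim/mnm_ind: m => [|i m IH]; first by rewrite mpolyX0 rmorph1 subrr; apply: ord_zero.
  rewrite mpolyXD rmorphM /= substX mdegD mdeg1.
  rewrite (_ : _ - _ = v i * (('X_[m] \mPo subst v) - 'X_[m]) + (v i - 'X_i) * 'X_[m]); last by ring.
  apply: ordD; first exact: (ordM (ov1 i) IH).
  exact: (ordM (ov i) (@ordX _ _ m)).
have step m : ord (mdeg m + l.+1) (('X_[m] \mPo subst u) - ('X_[m] \mPo subst v) - der W 'X_[m]).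
  elim/mnm_ind: m => [|i m IH].
    by rewrite mpolyX0 !rmorph1 der1 !subrr; apply: ord_zero.
  rewrite mpolyXD !rmorphM /= !substX derM derX mdegD mdeg1.
  set a := 'X_[m] \mPo subst u in IH *; set b := 'X_[m] \mPo subst v in IH *.
  have oab : ord (mdeg m + l) (a - b).
    rewrite -(subrK (der W 'X_[m]) (a - b)); apply: ordD.
      by apply: (ordW _ IH); rewrite addnS.
    by apply: ord_der => //; apply: ordX.
  (* Each summand gains the required order for its own reason: tangency of [u], the induction
     hypothesis, the choice of [W], tangency of [v]. *)
  rewrite (_ : _ - _ = (u i - 'X_i) * (a - b) + 'X_i * (a - b - der W 'X_[m])
     + (u i - v i - W i) * b + W i * (b - 'X_[m])); last by ring.
  apply: ordD; first apply: ordD; first apply: ordD.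
  - by apply: (ordW _ (ordM (ou i) oab)); lia.
  - by apply: (ordW _ (ordM (oX1 i) IH)); lia.
  - have ob : ord (mdeg m) b by apply: ord_subst => //; apply: ordX.
    by apply: (ordW _ (ordM (ouv i) ob)); lia.
  - by apply: (ordW _ (ordM (oW i) (stepv m))); lia.
move=> op; rewrite (comp_mpolyEX p (subst u)) (comp_mpolyEX p (subst v)).
rewrite [p in der W p]mpolyE (raddf_sum (der W)) -!sumrB big_seq.
apply: ord_sum => m ms; rewrite /= (der_is_scalable W) -!scalerBr; apply: ordZ.
apply: ordW (step m); rewrite leq_add2r leqNgt; apply/negP => /op; apply/eqP.
by rewrite -mcoeff_msupp.
Qed.

End LeadingTerms.

(** * Linearity, homogeneous parts, and maps agreeing up to a given degree *)

Section FpsLinear.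
Variables (K : fieldType) (n : nat).
Implicit Types (F H : fps K n) (f g u v X Y : fpsn K n) (m : 'X_{1..n}).

Lemma fps_truncB N F H c :
  fps_trunc N (fun m => F m - c * H m) = fps_trunc N F - c *: fps_trunc N H.
Proof.
rewrite /fps_trunc scaler_sumr -sumrB; apply: eq_bigr => m _.
by rewrite scalerBl scalerA.
Qed.

Lemma vf_applyBr X F H c : no_const X -> vf_apply X (fun m => F m - c * H m) =
  fun m => vf_apply X F m - c * vf_apply X H m.
Proof.
move=> X0; apply/funext => m; rewrite !(vf_applyE (N := mdeg m)) //.
by rewrite fps_truncB raddfB /= (der_is_scalable _ c) mcoeffB mcoeffZ.
Qed.

Lemma vf_applyBl X Y F c : no_const X -> no_const Y ->
  vf_apply (fun i m => Y i m - c * X i m) F =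
  fun m => vf_apply Y F m - c * vf_apply X F m.
Proof.
move=> X0 Y0; apply/funext => m; rewrite !(vf_applyE (N := mdeg m)) //; last first.
  by move=> i; rewrite X0 Y0 mulr0 subrr.
rewrite /der (eq_bigr (fun i => truncs (mdeg m) Y i * (fps_trunc (mdeg m) F)^`M(i)
    - c *: (truncs (mdeg m) X i * (fps_trunc (mdeg m) F)^`M(i)))) => [|i _].
  by rewrite sumrB -scaler_sumr mcoeffB mcoeffZ.
by rewrite /truncs fps_truncB mulrBl scalerAl.
Qed.

Lemma fps_compZ c F g : no_const g ->
  fps_comp (fun m => c * F m) g = fun m => c * fps_comp F g m.
Proof.
move=> g0; apply/funext => m; rewrite !(fps_compE (N := mdeg m)) //.
rewrite (_ : fps_trunc _ _ = c *: fps_trunc (mdeg m) F) ?comp_mpolyZ ?mcoeffZ //.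
by rewrite /fps_trunc scaler_sumr; apply: eq_bigr => i _; rewrite scalerA.
Qed.

Lemma vf_apply_fid X i : no_const X -> vf_apply X (fid K i) = X i.
Proof.
move=> X0; apply: trunc_inj => N _; apply: (ord_trans (trunc_vf_apply _ X0)).
rewrite -[X in ord _ (_ - X)](derX (truncs N X)); apply: der_congr.
- exact: truncs_ord1.
- by move=> j; rewrite subrr; apply: ord_zero.
- exact: trunc_of_poly.
Qed.

Definition fps_hom d F : {mpoly K[n]} :=
  fps_trunc d (fun m => if mdeg m == d then F m else 0).

Lemma fps_hom_homog d F : fps_hom d F \is d.-homog.
Proof.
apply: rpred_sum => m _; case: eqP => md; last by rewrite scale0r rpred0.
by apply: rpredZ; rewrite dhomogX /= md.
Qed.

Lemma ord_fps_hom d F : ord d (fps_hom d F).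
Proof. exact/ord_homog/fps_hom_homog. Qed.

Lemma mcoeff_fps_hom d F m : mdeg m = d -> (fps_hom d F)@_m = F m.
Proof. by move=> md; rewrite mcoeff_trunc md ?eqxx. Qed.

Lemma ord_trunc_hom d F p : (forall m, (mdeg m < d)%N -> F m = 0) ->
  (forall m, (mdeg m <= d)%N -> F m = p@_m) -> ord d.+1 (p - fps_hom d F).
Proof.
move=> F0 Fp m md; rewrite mcoeffB -Fp // mcoeff_trunc //.
case: eqP => [_|/eqP ne]; first by rewrite subrr.
by rewrite F0 ?subr0 // ltn_neqAle ne.
Qed.

(** The case [l = 0], [W = 0] of [taylor_subst], with [v] the identity. *)
Lemma subst_tangent d (u : 'I_n -> {mpoly K[n]}) p :
  (forall i, ord 2 (u i - 'X_i)) -> ord d p -> ord d.+1 ((p \mPo subst u) - p).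
Proof.
move=> ou op; rewrite -[X in ord _ (_ - X)]subst_id -[_ - _]subr0.
rewrite -(_ : der (fun _ => 0) p = 0); last by rewrite /der big1 // => i _; rewrite mul0r.
rewrite -addn1; apply: taylor_subst => //.
- by move=> i; rewrite subrr; apply: ord_zero.
- by move=> i; rewrite subr0.
- by move=> i; apply: ord_zero.
Qed.

Definition eqs d u v : Prop := forall i m, (mdeg m < d)%N -> u i m = v i m.

Lemma eqs_truncs N d u v : eqs d u v -> (d <= N.+1)%N ->
  forall i, ord d (truncs N u i - truncs N v i).
Proof.
move=> e dN i m md; have mN : (mdeg m <= N)%N by rewrite -ltnS (leq_trans md).
by rewrite mcoeffB !mcoeff_trunc // e // subrr.
Qed.

Lemma truncs_fid N i : (0 < N)%N -> truncs N (fid K (n := n)) i = 'X_i.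
Proof.
move=> N0; apply/mpolyP => m; have [mN|mN] := leqP (mdeg m) N.
  by rewrite mcoeff_trunc.
rewrite mcoeffX; have [em|_] := eqVneq U_(i)%MM m.
  by move: mN; rewrite -em mdeg1 ltnNge N0.
rewrite /truncs /fps_trunc raddf_sum big1 // => -[m' /= m'N] _.
rewrite mcoeffZ mcoeffX; case: eqP => [e|_]; last by rewrite mulr0.
by rewrite e ltnS leqNgt mN in m'N.
Qed.

Lemma eqs_fid_truncs N d u : (0 < N)%N -> eqs d u (@fid K n) -> (d <= N.+1)%N ->
  forall i, ord d (truncs N u i - 'X_i).
Proof. by move=> N0 e dN i; rewrite -(truncs_fid _ N0); apply: eqs_truncs. Qed.

Lemma tangent_to_idP u : no_const u -> tangent_to_id u <-> eqs 2 u (@fid K n).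
Proof.
move=> u0; split=> [tu i m|e]; last first.
  apply/matrixP => i j; rewrite !mxE e ?mdeg1 //.
  by rewrite /fid /fps_of_poly mcoeffXU.
rewrite ltnS leq_eqVlt ltnS leqn0 => /orP[/mdeg1P[j /eqP ->]|].
  have := congr1 (fun A : 'M_n => A i j) tu; rewrite !mxE => ->.
  by rewrite /fid /fps_of_poly mcoeffXU.
by rewrite mdeg_eq0 => /eqP ->; rewrite u0 no_const_fid.
Qed.

(** With u = id + a, the composite is v + a o v, and a o v agrees with a to one degree beyond the
    order of a. The resulting expression is symmetric in [u] and [v], which is how composites in
    both orders get compared. *)
Lemma eqs_fcomp_tangent d u v : eqs d.+1 u (@fid K n) -> eqs 2 v (@fid K n) ->
  eqs d.+2 (fcomp u v) (fun i m => u i m + v i m - fid K i m).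
Proof.
move=> eu ev i m md; pose N := d.+1.
have mN : (mdeg m <= N)%N by [].
have v0 : no_const v by move=> j; rewrite ev ?mdeg0 // no_const_fid.
rewrite /fcomp (fps_compE (N := N)) //.
have evN := eqs_fid_truncs (N := N) isT ev isT.
have := subst_tangent evN (eqs_fid_truncs (N := N) isT eu (leqnSn _) i).
move=> /(_ m md) /eqP; rewrite rmorphB /= substX.
rewrite !mcoeffB subr_eq0 subr_eq => /eqP ->.
by rewrite /truncs !mcoeff_trunc // [fid _ _ _]/(fps_of_poly _ _) /fps_of_poly; ring.
Qed.

Lemma eqs_fcomp d u u' v v' : no_const v -> no_const v' ->
  eqs d u u' -> eqs d v v' -> eqs d (fcomp u v) (fcomp u' v').
Proof.
case: d => // d v0 v'0 eu ev i m md; have mN : (mdeg m <= d)%N by [].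
rewrite /fcomp !(fps_compE (N := d)) //; apply/eqP; rewrite -subr_eq0 -mcoeffB; apply/eqP.
apply: (subst_congr (d := d.+1)) => //; first exact: truncs_ord1.
  exact: eqs_truncs.
exact: eqs_truncs.
Qed.

Lemma eqs_fcomp_id u f : no_const u -> eqs 2 f (@fid K n) -> eqs 2 (fcomp u f) u.
Proof.
move=> u0 ef i m md; have mN : (mdeg m <= 1)%N by [].
have f0 : no_const f by move=> j; rewrite ef ?mdeg0 // no_const_fid.
rewrite /fcomp (fps_compE (N := 1)) //.
have := subst_tangent (eqs_fid_truncs (N := 1) isT ef isT) (truncs_ord1 1 u0 i).
by move=> /(_ m md) /eqP; rewrite mcoeffB subr_eq0 => /eqP ->; rewrite mcoeff_trunc.
Qed.

End FpsLinear.

(** * The centralizer of a dicritic vector field *)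

Section Dicritic.
Variables (K : fieldType) (n : nat).
Hypothesis charK : [pchar K] =i pred0.
Variables (k : nat) (X : fpsn K n) (q : {mpoly K[n]}) (p : 'I_n -> {mpoly K[n]}).
Hypothesis XkX : X_k k X.
Hypothesis dicX : dicritic_form k X q p.
Implicit Types (u v Y : fpsn K n) (l N : nat).

Let hq : q \is k.-homog. Proof. by case: dicX. Qed.
Let hp i : p i \is k.+2.-homog. Proof. by case: dicX. Qed.
Let eX i m : (mdeg m <= k.+2)%N -> X i m = (q * 'X_i + p i)@_m.
Proof. by case: dicX => _ _; apply. Qed.
Let oX : ords k.+1 X. Proof. by case: XkX. Qed.
Let X0 : no_const X := ords_no_const oX.

(** [X] has a nonzero coefficient in degree k + 1, where [p] does not contribute. *)
Lemma dicritic_radial_neq0 : q != 0.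
Proof.
case: XkX => _ [i [m [md]]]; apply: contraNneq => q0.
by rewrite eX ?md // q0 mul0r add0r (ord_homog (hp i)) // md.
Qed.

Let oXN N i : (k <= N)%N -> ord k.+1 (truncs N X i).
Proof. by move=> kN; apply: ords_truncs. Qed.

Let leadX N i : (k < N)%N -> ord k.+2 (truncs N X i - q * 'X_i).
Proof.
move=> kN m md; have mN : (mdeg m <= N)%N by apply: leq_trans kN.
rewrite mcoeffB mcoeff_trunc // eX ?(ltnW md) // mcoeffD.
by rewrite (ord_homog (hp i)) // addr0 subrr.
Qed.

Let leadX2 N i : (k.+1 < N)%N -> ord k.+3 (truncs N X i - (q * 'X_i + p i)).
Proof.
move=> kN m md; have mN : (mdeg m <= N)%N by apply: leq_trans kN.
by rewrite mcoeffB mcoeff_trunc // eX ?subrr.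
Qed.

Lemma trunc_commute N Y i : no_const Y -> vf_apply X (Y i) = vf_apply Y (X i) ->
  ord N.+1 (der (truncs N X) (truncs N Y i) - der (truncs N Y) (truncs N X i)).
Proof.
move=> Y0 e; apply: (ord_trans (q := fps_trunc N (vf_apply X (Y i)))).
  exact/ord_subC/trunc_vf_apply.
by rewrite e; apply: trunc_vf_apply.
Qed.

Let homqX i : q * 'X_i \is k.+1.-homog. Proof. exact: homogMX. Qed.
Let ordqX i : ord k.+1 (q * 'X_i). Proof. exact: ord_homog. Qed.

Lemma radial_lead_eq0 l (W : 'I_n -> {mpoly K[n]}) : (0 < l)%N -> l != k ->
    (forall i, W i \is l.+1.-homog) ->
    (forall i, ord (k + l).+2 (der (fun j => q * 'X_j) (W i) - der W (q * 'X_i))) ->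
  forall i, W i = 0.
Proof.
move=> l0 lk hW oW; have := radial_commute hq hW oW.
exact: (radial_commute_eq0 charK dicritic_radial_neq0 hq l0 lk).
Qed.

(** Lowest order part of [X, Y] = 0; it sits in degree k + l + 1, whence the choice of [N]. *)
Lemma commute_lead l Y : ords l.+1 Y ->
    (forall i, vf_apply X (Y i) = vf_apply Y (X i)) ->
  let W i := fps_hom l.+1 (Y i) in
  forall i, ord (k + l).+2 (der (fun j => q * 'X_j) (W i) - der W (q * 'X_i)).
Proof.
move=> oY cY W i; pose N := (k + l).+1.
have Y0 := ords_no_const oY.
have oYN j : ord l.+1 (truncs N Y j) by apply: ords_truncs => //; rewrite /N; lia.
have lY j : ord l.+2 (truncs N Y j - W j).
  by apply: ord_trunc_hom => m md; [exact: oY|rewrite mcoeff_trunc // /N; lia].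
have XN j : ord k.+1 (truncs N X j) by apply: oXN; rewrite /N; lia.
have lXN j : ord k.+2 (truncs N X j - q * 'X_j) by apply: leadX; rewrite /N; lia.
apply: (ord_trans (q := der (truncs N X) (truncs N Y i))).
  apply: ord_subC; apply: (ordW (b := l.+1 + k + 1)); first lia.
  apply: der_congr_lead => //; first by move=> j; rewrite addn1.
    exact: ord_fps_hom.
  by rewrite addn1.
apply: (ord_trans (trunc_commute Y0 (cY i))).
apply: (ordW (b := k.+1 + l + 1)); first lia.
by apply: der_congr_lead => // [j|]; rewrite addn1.
Qed.

Lemma commute_raise_order l Y : (0 < l)%N -> l != k -> ords l.+1 Y ->
  (forall i, vf_apply X (Y i) = vf_apply Y (X i)) -> ords l.+2 Y.
Proof.
move=> l0 lk oY cY i m; rewrite ltnS leq_eqVlt => /orP[/eqP md|]; last exact: oY.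
rewrite -(mcoeff_fps_hom (Y i) md).
have hW j := fps_hom_homog l.+1 (Y j).
by rewrite (radial_lead_eq0 l0 lk hW (commute_lead oY cY)) mcoeff0.
Qed.

(** For invertible [u] this says u_* X = X; phrased on derivations, it involves no inverse. *)
Definition commuting u : Prop :=
  forall F, vf_apply X (fps_comp F u) = fps_comp (vf_apply X F) u.

Lemma commuting_fps u i : no_const u -> commuting u ->
  vf_apply X (u i) = fps_comp (X i) u.
Proof.
by move=> u0 cu; rewrite -{1}(fps_comp_fidl i u0) cu vf_apply_fid.
Qed.

(** Subtract the relations X(u_i) = X_i o u and X(v_i) = X_i o v. By [taylor_subst] the difference
    on the right is W(X_i) to lowest order, so [q R, W] vanishes for the part [W] of degree l + 1 of
    [u - v]. *)
Lemma commuting_raise_order l u v : (0 < l)%N -> l != k ->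
    eqs 2 u (@fid K n) -> eqs 2 v (@fid K n) ->
    commuting u -> commuting v -> eqs l.+1 u v ->
  eqs l.+2 u v.
Proof.
move=> l0 lk eu ev cu cv euv.
have u0 : no_const u by move=> j; rewrite eu ?mdeg0 // no_const_fid.
have v0 : no_const v by move=> j; rewrite ev ?mdeg0 // no_const_fid.
pose W i := fps_hom l.+1 (fun m => u i m - v i m).
have hW i : W i \is l.+1.-homog by apply: fps_hom_homog.
pose N := (k + l).+1.
have XN j : ord k.+1 (truncs N X j) by apply: oXN; rewrite /N; lia.
have lXN j : ord k.+2 (truncs N X j - q * 'X_j) by apply: leadX; rewrite /N; lia.
have lW j : ord l.+2 (truncs N u j - truncs N v j - W j).
  apply: ord_trunc_hom => m md; first by rewrite euv // subrr.
  by rewrite mcoeffB !mcoeff_trunc // /N; lia.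
have comN w i : no_const w -> commuting w ->
    ord N.+1 (der (truncs N X) (truncs N w i) - (truncs N X i \mPo subst (truncs N w))).
  move=> w0 cw; apply: (ord_trans (q := fps_trunc N (vf_apply X (w i)))).
    exact/ord_subC/trunc_vf_apply.
  by rewrite (commuting_fps _ w0 cw); apply: trunc_fps_comp.
have W0 : forall i, W i = 0.
  apply: (radial_lead_eq0 l0 lk hW) => i.
  apply: (ord_trans (q := der (truncs N X) (truncs N u i - truncs N v i))).
    apply: ord_subC; apply: (ordW (b := l.+1 + k + 1)); first lia.
    apply: der_congr_lead => //; first by move=> j; rewrite addn1.
      exact: ord_homog.
    by rewrite addn1.
  apply: (ord_trans (q := (truncs N X i \mPo subst (truncs N u))
      - (truncs N X i \mPo subst (truncs N v)))).
    by rewrite raddfB /= opprD addrACA -opprD; apply: ordB; apply: comN.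
  apply: (ord_trans (q := der W (truncs N X i))).
    apply: (ordW (b := k.+1 + l.+1)); first lia.
    apply: taylor_subst => //; last by move=> j; apply: ord_homog.
      by apply: eqs_fid_truncs.
    by apply: eqs_fid_truncs.
  rewrite -raddfB; apply: (ordW (b := k.+2 + l)); first lia.
  by apply: ord_der => // j; apply: ord_homog.
move=> i m; rewrite ltnS leq_eqVlt => /orP[/eqP md|]; last exact: euv.
apply/eqP; rewrite -subr_eq0.
by rewrite -(mcoeff_fps_hom (fun m => u i m - v i m) md) -/(W i) W0 mcoeff0.
Qed.

(** Past degree k + 1 the exceptional value [l = k] no longer occurs, and agreement propagates to
    every degree. *)
Lemma commuting_eq d u v : (k < d)%N -> eqs 2 u (@fid K n) -> eqs 2 v (@fid K n) ->
  commuting u -> commuting v -> eqs d.+1 u v -> u = v.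
Proof.
move=> kd eu ev cu cv euv.
have e j : eqs (d + j).+1 u v.
  elim: j => [|j IH]; first by rewrite addn0.
  by rewrite addnS; apply: commuting_raise_order => //; lia.
apply/funext => i; apply/funext => m; apply: (e (mdeg m)); lia.
Qed.

Lemma commuting_tangent_order d u : eqs 2 u (@fid K n) -> commuting u ->
  (d < k)%N -> eqs d.+2 u (@fid K n).
Proof.
move=> eu cu; elim: d => // d IH dk.
apply: commuting_raise_order => //; [lia| |apply: IH; lia].
by move=> F; rewrite !fps_comp_fid.
Qed.

(* Commuting tangent maps agree with the identity up to degree k, so u o v and
   v o u agree up to degree k + 1; that is beyond the only order at which two
   elements of the centralizer of X may differ. *)
Lemma commuting_abelian u v : (0 < k)%N ->
  eqs 2 u (@fid K n) -> eqs 2 v (@fid K n) -> commuting u -> commuting v ->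
  fcomp u v = fcomp v u.
Proof.
move=> k0 eu ev cu cv.
have u0 : no_const u by move=> j; rewrite eu ?mdeg0 // no_const_fid.
have v0 : no_const v by move=> j; rewrite ev ?mdeg0 // no_const_fid.
have comp_comm w w' : no_const w -> no_const w' -> commuting w -> commuting w' ->
    commuting (fcomp w w').
  by move=> w0 w'0 cw cw' F; rewrite -!fps_comp_assoc // cw' cw.
have tang w w' : no_const w -> eqs 2 w (@fid K n) -> eqs 2 w' (@fid K n) ->
    eqs 2 (fcomp w w') (@fid K n).
  by move=> w0 ew ew' i m md; rewrite (eqs_fcomp_id w0 ew') // ew.
have ku := commuting_tangent_order (d := k.-1) eu cu.
have kv := commuting_tangent_order (d := k.-1) ev cv.
rewrite prednK // leqnn in ku kv.
apply: (@commuting_eq k.+1) => //; try exact: tang; try exact: comp_comm.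
move=> i m md; rewrite (eqs_fcomp_tangent (ku isT) ev) // (eqs_fcomp_tangent (kv isT) eu) //.
by rewrite (addrC (v i m)).
Qed.

(** For [u] tangent to the identity, X(u_i) and X_i o u both start with q z_i, hence (1 - c) q z_i =
    0. *)
Lemma commuting_factor u c : eqs 2 u (@fid K n) ->
  (forall i, vf_apply X (u i) = fun m => c * fps_comp (X i) u m) -> c = 1.
Proof.
move=> eu cu; case: (XkX) => _ [i [m0 _]] {m0}.
have u0 : no_const u by move=> j; rewrite eu ?mdeg0 // no_const_fid.
pose N := k.+1; have eN := eqs_fid_truncs (N := N) isT eu isT.
have /eqP : (1 - c) *: (q * 'X_i) = 0.
  apply: (@homog_ord_eq0 _ _ k.+1); first exact: (rpredZ _ (homqX i)).
  have o1 : ord k.+2 (der (truncs N X) (truncs N u i) - q * 'X_i).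
    rewrite -(derX (fun j => q * 'X_j) i).
    apply: (ordW (b := 1 + k + 1)); first lia.
    apply: der_congr_lead.
    - by move=> j; apply: oXN.
    - by move=> j; rewrite addn1; apply: leadX.
    - exact: ordX1.
    - exact: eN.
  have o2 : ord k.+2 ((truncs N X i \mPo subst (truncs N u)) - q * 'X_i).
    apply: (ord_trans (q := truncs N X i)); last exact: leadX.
    by apply: subst_tangent => //; apply: oXN.
  rewrite scalerBl scale1r.
  have o3 : ord k.+2 (der (truncs N X) (truncs N u i)
      - c *: (truncs N X i \mPo subst (truncs N u))).
    move=> m md; rewrite mcoeffB mcoeffZ -vf_applyE // -fps_compE //.
    by rewrite cu subrr.
  apply: (ord_trans (ord_subC o1)); apply: (ord_trans o3).
  by rewrite -scalerBr; apply: ordZ.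
rewrite mscalerI mulf_eq0 (negPf dicritic_radial_neq0) /=.
rewrite subr_eq0 => /orP[/eqP //|].
by rewrite -msize_poly_eq0 msizeX.
Qed.


(** At the exceptional order [l = k] the relation makes all z_j W_i symmetric in i and j. With two
    distinct variables, z_i divides W_i for [i = i0], and the quotient [h] then serves for all
    components. *)
Lemma radial_multiple_lead (i0 j0 : 'I_n) (W : 'I_n -> {mpoly K[n]}) : i0 != j0 ->
    (0 < k)%N -> (forall i, W i \is k.+1.-homog) ->
    (forall i, q * W i *+ k = der W q * 'X_i) ->
  exists2 h, h \is k.-homog & forall i, W i = h * 'X_i.
Proof.
move=> ij k0 hW eW.
have XW i j : 'X_j * W i = 'X_i * W j.
  apply: (mulfI dicritic_radial_neq0); apply/eqP; rewrite -subr_eq0; apply/eqP.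
  apply: (mulrn_mpoly_eq0 charK k0).
  have -> : (q * ('X_j * W i) - q * ('X_i * W j)) *+ k =
      (q * W i *+ k) * 'X_j - (q * W j *+ k) * 'X_i.
    by rewrite mulrnBl !mulrnAl; congr (_ *+ _ - _ *+ _); ring.
  by rewrite !eW; ring.
have [h eh] := mulX_eq_dvd ij (XW i0 j0).
have X0' i : 'X_i != 0 :> {mpoly K[n]} by rewrite -msize_poly_eq0 msizeX.
exists h.
  apply/dhomogP => m ms; have : (m + U_(i0))%MM \in msupp (W i0).
    by rewrite eh (perm_mem (msuppMX _ _)) addmC map_f.
  by move/(dhomog_mf (hW i0)); rewrite /= mdegD mdeg1; lia.
move=> i; apply: (mulfI (X0' i0)); rewrite XW eh; ring.
Qed.

(* Compares the terms of degree 2k + 2 of [X, Y] = 0, where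
   Y = h R + T + higher order terms. *)
Lemma commute_second_order Y h : ords k.+1 Y ->
    (forall i, vf_apply X (Y i) = vf_apply Y (X i)) ->
    h \is k.-homog -> (forall i, fps_hom k.+1 (Y i) = h * 'X_i) ->
    let T i := fps_hom k.+2 (Y i) in
  forall i j, q * ('X_j * T i - 'X_i * T j) = h * ('X_j * p i - 'X_i * p j).
Proof.
move=> oY cY hh eh T; pose N := (k + k).+2.
have Y0 := ords_no_const oY.
have hT i : T i \is k.+2.-homog by apply: fps_hom_homog.
have hhX i : h * 'X_i \is k.+1.-homog by apply: homogMX.
have YN j : ord k.+1 (truncs N Y j) by apply: ords_truncs => //; rewrite /N; lia.
have XN j : ord k.+1 (truncs N X j) by apply: oXN; rewrite /N; lia.
have lXN j : ord k.+3 (truncs N X j - (q * 'X_j + p j)) by apply: leadX2; rewrite /N; lia.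
have lYN j : ord k.+3 (truncs N Y j - (h * 'X_j + T j)).
  move=> m md; have mN : (mdeg m <= N)%N by rewrite /N; lia.
  rewrite mcoeffB mcoeff_trunc // mcoeffD -eh.
  have [mk|mk] := eqVneq (mdeg m) k.+2.
    by rewrite (mcoeff_fps_hom _ mk) (dhomog_nemf_coeff (fps_hom_homog _ _)) /= ?mk ?add0r ?subrr // gtn_eqF.
  rewrite (dhomog_nemf_coeff (hT j)) // addr0.
  have [mk'|mk'] := eqVneq (mdeg m) k.+1; first by rewrite (mcoeff_fps_hom _ mk') subrr.
  by rewrite (dhomog_nemf_coeff (fps_hom_homog _ _)) // subr0 oY //; lia.
have qp1 j : ord k.+1 (q * 'X_j + p j).
  by apply: ordD => //; apply: (ordW _ (ord_homog (hp j))).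
have hT1 j : ord k.+1 (h * 'X_j + T j).
  by apply: ordD; [apply: ord_homog|apply: (ordW _ (ord_homog (hT j)))].
(* The bracket [q R, h R] is zero because [q] and [h] have equal degrees. In degree 2k + 2, Euler's
   identity gives [q * T i - h * p i] the factor k + 1, and the other terms are multiples of z_i. *)
have eqT i : (q * T i - h * p i) *+ k.+1 = (der T q - der p h) * 'X_i.
  have o1 : ord (k + k).+3 (der (fun j => q * 'X_j + p j) (h * 'X_i + T i)
       - der (fun j => h * 'X_j + T j) (q * 'X_i + p i)).
    apply: (ord_trans (q := der (truncs N X) (truncs N Y i))).
      apply: ord_subC; apply: (ordW (b := k.+1 + k + 2)); first lia.
      by apply: der_congr_lead => // [j|]; rewrite addn2.
    apply: (ord_trans (trunc_commute Y0 (cY i))).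
    apply: (ordW (b := k.+1 + k + 2)); first lia.
    by apply: der_congr_lead => // [j|]; rewrite addn2.
  apply/eqP; rewrite -subr_eq0; apply/eqP; apply: (@homog_ord_eq0 _ _ (k + k).+2).
    apply: rpredB.
      apply: rpredMn; apply: rpredB; rewrite -!addnS; exact: dhomogM.
    have -> : (k + k).+2 = (k + k.+1 + 1)%N by lia.
    by apply: dhomogM; [apply: rpredB; apply: homog_der|rewrite dhomogX /= mdeg1].
  (* [p, T] starts only in degree 2k + 3. *)
  have o2 : ord (k + k).+3 (der p (T i) - der T (p i)).
    by apply: ordB; apply: (ordW (b := k.+2 + k.+1)); try lia;
      apply: ord_der => [j|]; apply: ord_homog.
  rewrite (_ : _ - _ = (der (fun j => q * 'X_j + p j) (h * 'X_i + T i)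
       - der (fun j => h * 'X_j + T j) (q * 'X_i + p i)) - (der p (T i) - der T (p i))).
    exact: ordB.
  have rT : der (fun j => q * 'X_j) (T i) = q * T i *+ k.+1 + q * T i.
    by rewrite (der_radial_field _ (hT i)) mulrSr.
  have rp : der (fun j => h * 'X_j) (p i) = h * p i *+ k.+1 + h * p i.
    by rewrite (der_radial_field _ (hp i)) mulrSr.
  have rh := der_radial_field q (hhX i); have rq := der_radial_field h (homqX i).
  rewrite !derDl !raddfD /= rT rp rh rq (derM p h) (derM T q) !derX.
  move: (der p h) (der T q) (der p (T i)) (der T (p i)) => a1 a2 a3 a4.
  move: (T i) (p i) => t s; move: (k.+1) => d; ring.
move=> i j; apply/eqP; rewrite -subr_eq0; apply/eqP.
apply: (mulrn_mpoly_eq0 charK (ltn0Sn k)).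
(* Antisymmetrizing in [i] and [j] cancels the multiples of z_i and z_j. *)
have -> : (q * ('X_j * T i - 'X_i * T j) - h * ('X_j * p i - 'X_i * p j)) *+ k.+1 =
    (q * T i - h * p i) *+ k.+1 * 'X_j - (q * T j - h * p j) *+ k.+1 * 'X_i.
  by move: (T i) (p i) (T j) (p j) (k.+1) => t s t' s' d; ring.
by rewrite !eqT; ring.
Qed.

Lemma commute_proportional Y (i0 j0 : 'I_n) : (0 < k)%N ->
    mpoly_coprime q ('X_j0 * p i0 - 'X_i0 * p j0) -> ords k.+1 Y ->
    (forall i, vf_apply X (Y i) = vf_apply Y (X i)) ->
  exists c, Y = fun i m => c * X i m.
Proof.
move=> k0 cop oY cY; have q0 := dicritic_radial_neq0.
have Y0 := ords_no_const oY.
(* For equal indices the second polynomial is zero, so coprimality would make [q] a unit, of degree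
   0, against [k > 0]. *)
have ij : i0 != j0.
  apply: contraTneq k0 => ij; rewrite -leqNgt leqn0; apply/eqP.
  have uq : q \is a GRing.unit.
    by apply: (cop q 1 0); rewrite ?mulr1 // ij subrr mulr0.
  apply: (dhomog_uniq q0 hq); move: uq => /andP[/eqP -> _].
  by rewrite -alg_mpolyC; apply: rpredZ; apply: dhomog1.
have hW i := fps_hom_homog k.+1 (Y i).
have [h hh eh] := radial_multiple_lead ij k0 hW (radial_commute hq hW (commute_lead oY cY)).
have [c' ec'] := mpoly_coprime_euclid q0 cop (commute_second_order oY cY hh eh i0 j0).
(* [h = q * c'] and [q] are homogeneous of the same degree, so only the constant term of [c']
   counts. *)
pose c := c'@_0%MM; exists c.
have hc : h = c *: q.
  apply/eqP; rewrite -subr_eq0; apply/eqP; apply: (@homog_ord_eq0 _ _ k).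
    by apply: rpredB => //; apply: rpredZ.
  rewrite ec' -mul_mpolyC mulrC -mulrBl addrC -[k.+1]add1n.
  apply: ordM; last exact: ord_homog.
  move=> m; rewrite ltnS leqn0 mdeg_eq0 => /eqP ->.
  by rewrite mcoeffD mcoeffN mcoeffC eqxx mulr1 addrC subrr.
(* [Z] commutes with [X], and [h = c *: q] kills its part of degree k + 1. From there on every order
   exceeds the exceptional one and can be raised, so [Z] vanishes. *)
pose Z : fpsn K n := fun i m => Y i m - c * X i m.
have Z0 : no_const Z by move=> i; rewrite /Z X0 Y0 mulr0 subrr.
have cZ i : vf_apply X (Z i) = vf_apply Z (X i).
  by rewrite /Z vf_applyBr // vf_applyBl // cY.
have oZ d : ords (k + d).+2 Z.
  elim: d => [|d IH].
    rewrite addn0 => i m; rewrite ltnS leq_eqVlt => /orP[/eqP md|md]; last first.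
      by rewrite /Z oY // oX // mulr0 subrr.
    rewrite /Z -(mcoeff_fps_hom (Y i) md) eh hc eX ?md // mcoeffD.
    by rewrite (ord_homog (hp i)) ?md // addr0 -scalerAl mcoeffZ subrr.
  by rewrite addnS; apply: commute_raise_order => //; lia.
apply/funext => i; apply/funext => m; apply/eqP; rewrite -subr_eq0.
by rewrite -[_ - _]/(Z i m) (oZ (mdeg m)) //; lia.
Qed.

End Dicritic.

(** * The two implications for a subgroup of formal diffeomorphisms *)

Section Main.
Variables (K : fieldType) (n : nat).
Hypothesis charK : [pchar K] =i pred0.
Variable G : fpsn K n -> Prop.
Hypothesis GG : diffeo_subgroup G.

Lemma formal_diffeo_no_const (f : fpsn K n) : formal_diffeo f -> no_const f.
Proof. by case. Qed.

Lemma diffeo_subgroup_no_const f : G f -> no_const f.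
Proof. by case: GG => diffG _ _ _ /diffG /formal_diffeo_no_const. Qed.

(** By uniqueness of inverses, [h] is the inverse that the subgroup axioms place in [G]. *)
Lemma inverse_maps_mem g h : G g -> no_const h -> inverse_maps g h -> G h.
Proof.
case: GG => _ _ _ invG gG h0 [gh hg]; have [h' Gh' [gh' h'g]] := invG g gG.
have g0 := diffeo_subgroup_no_const gG; have h'0 := diffeo_subgroup_no_const Gh'.
suff -> : h = h' by [].
by rewrite -(fid_fcomp h0) -h'g fcomp_assoc // gh fcomp_fid.
Qed.

Lemma quasi_abelian_invariant f : G f -> regular_dicritic_diffeo f ->
  quasi_abelian G ->
  exists X : fpsn K n, regular_dicritic_vf X /\ projectively_invariant G X.
Proof.
move=> Gf [k k1 [X [Dkf XkX expXf] rdX]] qaG.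
exists X; split; first by exists k.
move=> g h Gg ihg /formal_diffeo_no_const h0.
have Gh := inverse_maps_mem Gg h0 ihg; case: ihg => gh hg.
have f0 := diffeo_subgroup_no_const Gf; have g0 := diffeo_subgroup_no_const Gg.
have oX : ords k.+1 X by case: XkX.
have X2 : ords 2 X by move=> i m m2; apply: oX; lia.
have X0 := ords_no_const X2.
have ef : eqs 2 f (@fid K n).
  move=> i m m2; case: Dkf => /(_ i m) e _; apply/eqP; rewrite -subr_eq0.
  by rewrite e //; lia.
case: GG => _ _ compG _.
have Gt : G (fcomp h (fcomp f g)) by exact: (compG _ _ Gh (compG _ _ Gf Gg)).
(* Up to degree 1, [fcomp h f] agrees with [h] as [f] is tangent to the identity; hence the
   conjugate of [f] agrees with [fcomp h g = fid]. *)
have et : eqs 2 (fcomp h (fcomp f g)) (@fid K n).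
  rewrite -fcomp_assoc // => i m m2.
  have hf0 := no_const_fcomp h0 f0.
  rewrite (eqs_fcomp (d := 2) (u' := h) (v' := g)) ?hg //.
  exact: eqs_fcomp_id.
have tf : fcomp (fcomp h (fcomp f g)) f = fcomp f (fcomp h (fcomp f g)).
  apply: qaG => //; apply/tangent_to_idP => //.
  exact: diffeo_subgroup_no_const.
have cY := pushforward_commute charK X2 f0 expXf g0 h0 gh hg tf.
have oY : ords k.+1 (pushforward g h X).
  move=> i m mk; rewrite /pushforward (fps_compE (N := k)) //.
  suff : ord k.+1 (fps_trunc k (vf_apply X (g i)) \mPo subst (truncs k h)) by apply.
  apply: ord_subst; first exact: truncs_ord1.
  move=> m' m'k; rewrite mcoeff_trunc // (vf_applyE (N := k)) //.
  suff : ord k.+1 (der (truncs k X) (fps_trunc k (g i))) by apply.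
  by apply: ord_derl; apply: ords_truncs.
case: rdX => _ [q [p [dicX [i0 [j0 cop]]]]].
exact: (commute_proportional charK XkX dicX k1 cop oY cY).
Qed.

(** Composing g_* X = c X with [g] gives X(g_i) = c (X_i o g), so c = 1 by [commuting_factor]; g_* X
    = X, read on derivations, is then the commutation of [X] with the substitution of [g]. *)
Lemma invariant_commuting k X q p g : X_k k X -> dicritic_form k X q p ->
    projectively_invariant G X -> G g -> tangent_to_id g ->
  eqs 2 g (@fid K n) /\ commuting X g.
Proof.
move=> XkX dicX piX Gg tg; have g0 := diffeo_subgroup_no_const Gg.
have /tangent_to_idP eg := tg; have {}eg := eg g0; split=> //.
case: (GG) => diffG _ _ invG; have [h Gh ihg] := invG g Gg.
have [c ec] := piX g h Gg ihg (diffG h Gh); case: ihg => gh hg.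
have h0 := diffeo_subgroup_no_const Gh.
have X0 : no_const X by case: XkX => oX _; apply: ords_no_const oX.
have c1 : c = 1.
  apply: (commuting_factor XkX dicX eg) => i.
  rewrite -fps_compZ // -[fun m => _](congr1 (fun Y => Y i) ec) /pushforward.
  by rewrite fps_comp_assoc // hg fps_comp_fid.
have eX : pushforward g h X = X.
  by rewrite ec c1; apply/funext => i; apply/funext => m; rewrite mul1r.
move=> F; rewrite -{2}eX vf_apply_pushforward // fps_comp_assoc // hg.
by rewrite fps_comp_fid.
Qed.

Lemma invariant_quasi_abelian X : regular_dicritic_vf X ->
  projectively_invariant G X -> quasi_abelian G.
Proof.
move=> [k k1 [XkX [q [p [dicX _]]]]] piX f g Gf tf Gg tg.
have [ef cf] := invariant_commuting XkX dicX piX Gf tf.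
have [eg cg] := invariant_commuting XkX dicX piX Gg tg.
exact: (commuting_abelian charK XkX dicX k1 ef eg cf cg).
Qed.

End Main.

Theorem theorem1p18 (R : realType) (n : nat) (G : fpsn R[i] n -> Prop)
    (hG : diffeo_subgroup G)
    (hreg : exists f, G f /\ regular_dicritic_diffeo f) :
  quasi_abelian G <->
  exists X : fpsn R[i] n, regular_dicritic_vf X /\ projectively_invariant G X.
Proof.
have charC : [pchar R[i]] =i pred0 by apply: Num.Theory.pchar_num.
split=> [qaG|[X [rdX piX]]]; last exact: (invariant_quasi_abelian charC hG rdX piX).
by case: hreg => f [Gf rdf]; apply: (quasi_abelian_invariant charC hG Gf rdf qaG).
Qed.
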